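(* Let $H$ be a Hilbert space and $\mathcal A=B(H)$ the algebra of all bounded operators on $H$. On the standard Hilbert module $l^2(B(H))$ there holds $$\chi^*(E)\le\lambda(E)\le\sqrt{\|E\|I^*(E)}\le\sqrt{\|E\|\alpha^*(E)}\le\sqrt{2\|E\|\chi^*(E)}$$ for any bounded balanced set $E\subseteq l^2(B(H))$, i.e. a bounded set for which $x\in E$ and $u\in B(H)$ unitary implies $xu\in E$. Here $\|E\|=\sup_{x\in E}\|x\|$.
   Context: $l^2(\mathcal A)$ is the right $\mathcal A$-module of all sequences $x=(\xi_1,\xi_2,\dots)$ in $\mathcal A$ for which $\sum_{j}\xi_j^*\xi_j$ converges in norm, with $\mathcal A$-valued inner product $\langle x,y\rangle=\sum_j\xi_j^*\eta_j$ (for $y=(\eta_1,\eta_2,\dots)$), norm $\|x\|=\|\langle x,x\rangle\|^{1/2}$ and module action $(\xi_1,\xi_2,\dots)a=(\xi_1a,\xi_2a,\dots)$. A free finitely generated submodule $M\le l^2(\mathcal A)$ is a closed $\mathcal A$-submodule isomorphic, as a Hilbert $\mathcal A$-module, to $\mathcal A^n$ for some $n\in\mathbb N$. For a bounded set $E$, $\lambda(E)$ is the greatest lower bound of all $\eta>0$ for which there is a free finitely generated submodule $M\le l^2(\mathcal A)$ with $\sup_{x\in E}\inf_{y\in M}\|x-y\|<\eta$. Let $P$ be the set of all semi-norms $p_{\varphi,y}(x)=\sqrt{\sum_{j=1}^\infty|\varphi(\eta_j^*\xi_j)|^2}$, $x=(\xi_1,\xi_2,\dots)\in l^2(\mathcal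 A)$, where $\varphi\in\mathcal A_*$ is a normal state and $y=(\eta_1,\eta_2,\dots)$ is a sequence of elements of $\mathcal A$ with $\sup_{j\ge1}\varphi(\eta_j^*\eta_j)=1$. For a bounded set $E$ and $p\in P$: $[\alpha(E)](p)$ is the infimum of all $\varepsilon>0$ such that $E=\bigcup_{i=1}^nS_i$ for some finitely many sets $S_i$ with $p(x'-x'')<\varepsilon$ for all $x',x''\in S_i$; $[\chi(E)](p)$ is the infimum of all $\varepsilon>0$ such that $E\subseteq\bigcup_{i=1}^n\{z:p(z-x_i)<\varepsilon\}$ for some finitely many $x_1,\dots,x_n\in l^2(\mathcal A)$; $[I(E)](p)$ is the supremum of all $\varepsilon>0$ for which there is an infinite set $S\subseteq E$ with $p(x'-x'')\ge\varepsilon$ for all distinct $x',x''\in S$ (and $0$ if there is no such $\varepsilon$). For $\mu\in\{\alpha,\chi,I\}$, $\mu^*(E)=\sup_{p\in P}[\mu(E)](p)$. *)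

(* Defs.v *)
From HB Require Import structures.
From mathcomp Require Import all_boot all_order all_algebra.
From mathcomp Require Import sesquilinear complex.
From mathcomp Require Import all_classical all_reals all_analysis.

Set Implicit Arguments.
Unset Strict Implicit.
Unset Printing Implicit Defensive.

Import Order.TTheory GRing.Theory Num.Theory.
Import numFieldNormedType.Exports.

Local Open Scope classical_set_scope.
Local Open Scope ring_scope.
Local Open Scope complex_scope.

(* Norms on modules over R[i] take values in R[i]; nrm is the same number as a
   real. For z : R[i]^o, nrm z is the modulus of z. *)
Definition nrm {R : realType} {V : normedModType R[i]} (x : V) : R :=
  complex.Re `|x|.

(* Complex Hilbert spaces of arbitrary dimension; the inner product is linear
   in its first argument. *)
Record hilbertType (R : realType) := Hilbert {
  hilbert_sort :> completeNormedModType R[i];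
  hdot : {dot hilbert_sort for Num.conj};
  hdot_norm : forall x, hdot x x = `|x| ^+ 2 }.
Arguments hdot {R h}.

Section NrmTheory.
Context {R : realType} {V : normedModType R[i]}.
Implicit Types x y : V.

Lemma nrmE x : (nrm x)%:C = `|x|.
Proof. by rewrite /nrm RRe_real// normr_real. Qed.

Lemma nrm_ge0 x : 0 <= nrm x.
Proof. by rewrite -lecR nrmE; exact: normr_ge0. Qed.

Lemma ler_nrmD x y : nrm (x + y) <= nrm x + nrm y.
Proof. by rewrite -lecR rmorphD /= !nrmE ler_normD. Qed.

Lemma nrmZ (a : R[i]) x : nrm (a *: x) = nrm (a : R[i]^o) * nrm x.
Proof.
by apply: (fmorph_inj (real_complex R)); rewrite rmorphM /= !nrmE normrZ.
Qed.

Lemma nrm0 : nrm (0 : V) = 0.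
Proof. by rewrite /nrm normr0. Qed.

Lemma nrm0_eq0 x : nrm x = 0 -> x = 0.
Proof. by move=> x0; apply/eqP; rewrite -normr_eq0 -nrmE x0. Qed.

End NrmTheory.

Section BoundedOperators.
Context {R : realType} (H : hilbertType R).

Definition bounded_linear : {pred (H -> H)} :=
  fun T => `[< linear T /\ exists C : R, forall x, nrm (T x) <= C * nrm x >].

Record bop := Bop { bop_fun :> H -> H; bopP : bop_fun \in bounded_linear }.

HB.instance Definition _ := [isSub for bop_fun].
HB.instance Definition _ := [Choice of bop by <:].

Lemma bounded_linearP (T : H -> H) :
  T \in bounded_linear <->
  linear T /\ exists C : R, forall x, nrm (T x) <= C * nrm x.
Proof. by split=> [/asboolP|?]; last exact/asboolP. Qed.

Lemma bounded_linear_submod : GRing.submod_closed (bounded_linear : {pred (H -> H)}).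
Proof.
split=> [|a S T /bounded_linearP[Sl [C SC]] /bounded_linearP[Tl [D TD]]].
  apply/bounded_linearP; split; first by move=> a x y; rewrite /= scaler0 addr0.
  by exists 0 => x; rewrite nrm0 mul0r.
apply/bounded_linearP; split.
  move=> b x y; rewrite !fctE Sl Tl !scalerDr !scalerA [a * b]mulrC.
  by rewrite addrACA.
exists (nrm (a : R[i]^o) * C + D) => x; rewrite !fctE.
by rewrite (le_trans (ler_nrmD _ _))// nrmZ mulrDl -mulrA lerD ?ler_wpM2l ?nrm_ge0.
Qed.

HB.instance Definition _ :=
  GRing.isSubmodClosed.Build R[i] (H -> H) bounded_linear bounded_linear_submod.
HB.instance Definition _ := [SubChoice_isSubLmodule of bop by <:].

Lemma bop_linear (T : bop) : linear T.
Proof. by have /bounded_linearP[] := bopP T. Qed.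

HB.instance Definition _ (T : bop) :=
  GRing.isLinear.Build R[i] H H *:%R T (bop_linear T).

Lemma bop_bounded (T : bop) : exists C : R, forall x, nrm (T x) <= C * nrm x.
Proof. by have /bounded_linearP[] := bopP T. Qed.

Lemma bopext (S T : bop) : S =1 T -> S = T.
Proof. by move=> /funext ST; exact: val_inj. Qed.

Lemma bopDE (S T : bop) x : (S + T) x = S x + T x. Proof. by []. Qed.
Lemma bopZE a (T : bop) x : (a *: T) x = a *: T x. Proof. by []. Qed.

Lemma bop1_subproof : idfun \in bounded_linear.
Proof. by apply/bounded_linearP; split=> //; exists 1 => x; rewrite mul1r. Qed.

Lemma bopM_subproof (S T : bop) : S \o T \in bounded_linear.
Proof.
have [C SC] := bop_bounded S; have [D TD] := bop_bounded T.
apply/bounded_linearP; split; first by move=> a x y /=; rewrite !linearP.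
exists (`|C| * D) => x /=; rewrite (le_trans (SC _))// -mulrA.
rewrite (le_trans (ler_wpM2r (nrm_ge0 _) (ler_norm C)))//.
by rewrite ler_wpM2l.
Qed.

Definition bop1 : bop := Bop bop1_subproof.
Definition bopM (S T : bop) : bop := Bop (bopM_subproof S T).

Lemma bopMA : associative bopM. Proof. by move=> S T U; exact: bopext. Qed.
Lemma bop1M : left_id bop1 bopM. Proof. by move=> S; exact: bopext. Qed.
Lemma bopM1 : right_id bop1 bopM. Proof. by move=> S; exact: bopext. Qed.
Lemma bopMDl : left_distributive bopM +%R.
Proof. by move=> S T U; exact: bopext. Qed.
Lemma bopMDr : right_distributive bopM +%R.
Proof. by move=> S T U; apply: bopext => x; exact: linearD. Qed.

HB.instance Definition _ :=
  GRing.Zmodule_isPzRing.Build bop bopMA bop1M bopM1 bopMDl bopMDr.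

Definition opnorm (T : bop) : R := sup [set nrm (T x) | x in [set x : H | nrm x <= 1]].

Lemma opnorm_has_sup (T : bop) : has_sup [set nrm (T x) | x in [set x : H | nrm x <= 1]].
Proof.
have [C TC] := bop_bounded T; split.
  by exists (nrm (T 0)), 0 => //=; rewrite nrm0.
exists `|C| => _ [x /= x1 <-]; rewrite (le_trans (TC x))//.
rewrite (le_trans (ler_wpM2r (nrm_ge0 _) (ler_norm C)))//.
by rewrite -[leRHS]mulr1 ler_wpM2l.
Qed.

Lemma opnorm_ub (T : bop) x : nrm x <= 1 -> nrm (T x) <= opnorm T.
Proof. by move=> x1; apply: (sup_upper_bound (opnorm_has_sup T)); exists x. Qed.

Lemma opnorm_le (T : bop) (C : R) :
  (forall x, nrm x <= 1 -> nrm (T x) <= C) -> opnorm T <= C.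
Proof.
move=> TC; apply: ge_sup; first by have [] := opnorm_has_sup T.
by move=> _ [x /= x1 <-]; exact: TC.
Qed.

Let norm (T : bop) : R[i] := (opnorm T)%:C.

Let ler_normD S T : norm (S + T) <= norm S + norm T.
Proof.
rewrite -rmorphD lecR; apply: opnorm_le => x x1.
by rewrite bopDE (le_trans (ler_nrmD _ _))// lerD ?opnorm_ub.
Qed.

Let opnormZ_le (a : R[i]) T : opnorm (a *: T) <= nrm (a : R[i]^o) * opnorm T.
Proof.
by apply: opnorm_le => x x1; rewrite bopZE nrmZ ler_wpM2l ?nrm_ge0 ?opnorm_ub.
Qed.

Let normrZ (a : R[i]) T : norm (a *: T) = `|a| * norm T.
Proof.
rewrite -(nrmE (a : R[i]^o)) -rmorphM; congr (_%:C); apply/eqP.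
rewrite eq_le opnormZ_le /=; have [->|a0] := eqVneq a 0.
  rewrite nrm0 mul0r (le_trans (nrm_ge0 ((0 *: T) 0)))//.
  by rewrite opnorm_ub// nrm0.
have na : 0 < nrm (a : R[i]^o).
  by rewrite lt_def nrm_ge0 andbT; apply: contra a0 => /eqP/nrm0_eq0 ->.
rewrite -ler_pdivlMl// -{1}[T]scale1r -(mulVf a0) -scalerA.
rewrite (le_trans (opnormZ_le _ _))//.
suff -> : nrm (a^-1 : R[i]^o) = (nrm (a : R[i]^o))^-1 by [].
apply: (fmorph_inj (real_complex R)).
by rewrite fmorphV /= !nrmE normfV.
Qed.

Let normr0_eq0 T : norm T = 0 -> T = 0.
Proof.
move=> /(congr1 (@complex.Re R)) /= T0; apply: bopext => x.
apply: nrm0_eq0; apply/eqP; rewrite eq_le nrm_ge0 andbT.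
have [->|x0] := eqVneq x 0; first by rewrite linear0 nrm0.
have nx : nrm x != 0 by apply: contra x0 => /eqP/nrm0_eq0 ->.
have := @opnorm_ub T ((nrm x)^-1%:C *: x); rewrite T0 linearZ /= !nrmZ.
have -> : nrm ((nrm x)^-1%:C : R[i]^o) = (nrm x)^-1.
  apply: (fmorph_inj (real_complex R)); rewrite /= nrmE.
  by rewrite ger0_norm// lecR invr_ge0 nrm_ge0.
rewrite mulVf// => /(_ (lexx _)); rewrite ler_pdivrMl ?mulr0//.
by rewrite lt_def nx nrm_ge0.
Qed.

(* B(H) as a normed space, for the operator norm. *)
HB.instance Definition _ :=
  Lmodule_isNormed.Build R[i] bop ler_normD normrZ normr0_eq0.

End BoundedOperators.
Arguments bop {R} H.

Section StandardModule.
Context {R : realType} {H : hilbertType R}.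
Local Notation A := (bop H).
Implicit Types (x y : nat -> A) (E M : set (nat -> A)) (phi : {linear A -> R[i]^o}).

(* The defining property determines at most one operator, and one exists by
   the Riesz representation theorem. *)
Definition adj (a : A) : A :=
  xget 0 [set b : A | forall h k : H, hdot (a h) k = hdot h (b k)].

Definition unitary (u : A) := adj u * u = 1 /\ u * adj u = 1.

(* The carrier of the standard Hilbert module, as a set of sequences; sums are
   limits for the operator norm. *)
Definition l2 : set (nat -> A) :=
  [set x | cvgn (series (fun j => adj (x j) * x j))].

Definition l2dot x y : A := limn (series (fun j => adj (x j) * y j)).

Definition l2norm x : R := Num.sqrt (nrm (l2dot x x)).

Definition l2act x (a : A) : nat -> A := fun j => x j * a.

Definition balanced E := forall x u, E x -> unitary u -> E (l2act x u).

Definition l2bounded E := exists C : R, forall x, E x -> l2norm x <= C.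

(* Suprema in [0, +oo]: the empty supremum is 0. *)
Definition esup0 (S : set (\bar R)) : \bar R := ereal_sup (0%E |` S).

Definition l2sup E : \bar R := esup0 [set (l2norm x)%:E | x in E].

Definition closed_submodule M :=
  [/\ M `<=` l2, M 0,
      forall x y, M x -> M y -> M (x + y),
      forall x a, M x -> M (l2act x a) &
      forall (z : nat -> nat -> A) x, (forall k, M (z k)) -> l2 x ->
        l2norm (z k - x) @[k --> \oo] --> (0 : R) -> M x].

(* M is the image of A^n under an A-linear bijection preserving the A-valued
   inner products. *)
Definition free_fg M := closed_submodule M /\
  exists (n : nat) (f : ('I_n -> A) -> nat -> A),
    [/\ forall a b, f (a + b) = f a + f b,
        forall a c, f (fun i => a i * c) = l2act (f a) c,
        forall a b, l2dot (f a) (f b) = \sum_(i < n) adj (a i) * b i,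
        injective f & range f = M].

Definition lambda E : \bar R := ereal_inf [set eta%:E | eta in
  [set eta : R | 0 < eta /\ exists2 M, free_fg M &
    (ereal_sup [set ereal_inf [set (l2norm (x - y)%R)%:E | y in M] | x in E]
      < eta%:E)%E]].

(* Continuity at 0 for the topology on B(H) generated by the semi-norms
   a |-> |\sum_k <a h_k, g_k>| with \sum_k |h_k|^2 and \sum_k |g_k|^2 finite;
   the continuous linear functionals form the predual of B(H). *)
Definition sqsummable (h : nat -> H) :=
  cvgn (series (fun k => nrm (h k) ^+ 2 : R)).

Definition sigma_weak_seminorm (h g : nat -> H) (a : A) : R :=
  nrm (limn (series (fun k => hdot (a (h k)) (g k) : R[i]^o))).

Definition in_predual phi := forall e : R, 0 < e ->
  exists (n : nat) (h g : 'I_n -> nat -> H) (d : R),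
    [/\ forall i, sqsummable (h i), forall i, sqsummable (g i), 0 < d &
        forall a, (forall i, sigma_weak_seminorm (h i) (g i) a < d) ->
          nrm (phi a) < e].

Definition normal_state phi :=
  [/\ in_predual phi, forall a : A, (0 : R[i]) <= phi (adj a * a) & phi 1 = 1].

Definition seminorm phi y x : \bar R :=
  sqrte (\sum_(0 <= j <oo) (nrm (phi (adj (y j) * x j)) ^+ 2)%:E).

Definition seminorms : set ((nat -> A) -> \bar R) :=
  [set p | exists phi y, [/\ normal_state phi,
     ereal_sup (range (fun j => (complex.Re (phi (adj (y j) * y j)))%:E)) = 1%E
     & p = seminorm phi y]].

Implicit Type p : (nat -> A) -> \bar R.

Definition alpha E p : \bar R := ereal_inf [set e%:E | e in
  [set e : R | 0 < e /\ exists (n : nat) (S : 'I_n -> set (nat -> A)),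
    E = \bigcup_i S i /\
    forall i x x', S i x -> S i x' -> (p (x - x')%R < e%:E)%E]].

Definition chi E p : \bar R := ereal_inf [set e%:E | e in
  [set e : R | 0 < e /\ exists (n : nat) (c : 'I_n -> nat -> A),
    (forall i, l2 (c i)) /\
    E `<=` \bigcup_i [set z | (p (z - c i)%R < e%:E)%E]]].

Definition istratescu E p : \bar R := esup0 [set e%:E | e in
  [set e : R | 0 < e /\ exists S : set (nat -> A),
    [/\ S `<=` E, infinite_set S &
        forall x x', S x -> S x' -> x <> x' -> (e%:E <= p (x - x')%R)%E]]].

Definition star (mu : set (nat -> A) -> ((nat -> A) -> \bar R) -> \bar R) E :=
  esup0 [set mu E p | p in seminorms].

End StandardModule.

(* Main.v *)
Require Import Defs.
From HB Require Import structures.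
From mathcomp Require Import all_boot all_order all_algebra.
From mathcomp Require Import sesquilinear complex.
From mathcomp Require Import all_classical all_reals all_analysis.
From mathcomp Require Import ring lra.

(** The inequalities rest on three facts; in the first two, p = p_(phi, y) is any of the
    semi-norms.

    First, p is dominated by the norm: since phi(y_j* y_j) <= 1, Cauchy-Schwarz for phi
    gives |phi(y_j* x_j)|^2 <= phi(x_j* x_j), and the sum over j is at most
    phi(<x, x>) <= |<x, x>| (sum_coef_le, seminorm_le_l2norm). That a state has norm at
    most 1 is obtained from Cauchy-Schwarz by iterated squaring (state_le_nrm).

    Secondly, the elements of bounded norm of a free finitely generated submodule M form
    a totally bounded set for p. They are combinations of finitely many generators with
    bounded coefficients, so their tails are uniformly small (free_uniform_tail), and p
    of the remaining finitely many coordinates depends only on a bounded set of numerical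
    vectors (finite_net). A set that is within eta of M therefore has, for p, a finite net
    of mesh eta + e for every e > 0; this is chi <= lambda (chi_le_lambda).

    Thirdly, I* dominates lambda itself. If lambda(E) > d, then for every n some element
    of E lies farther than d from the free module of sequences supported on the first n
    coordinates, so its tail from n on has norm larger than d (far_tail). The size of a
    tail is seen at a unit vector of H, and since E is balanced and the unitary group is
    transitive on the unit sphere (unitary_transitive), these vectors can all be taken
    equal to one vector h.
    A gliding hump then produces x_1, x_2, ... in E that are large at h on successive
    disjoint blocks and small beyond their own block (hump). For the vector state of h
    and the sequence y whose restriction to the k-th block is x_k, normalized at h, the
    x_k are separated by almost d (separated_sequence), whence lambda <= I*
    (lambda_le_istratescu). As lambda <= |E| by comparison with M = 0, lambda is at most
    the geometric mean of |E| and I*.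

    The remaining inequalities hold for each p: a set of p-diameter less than e contains
    at most one point of an e-separated set (istratescu_le_alpha), and a p-ball of radius
    e has p-diameter at most 2 e (alpha_le_chi). *)

Set Implicit Arguments.
Unset Strict Implicit.
Unset Printing Implicit Defensive.

Import Order.TTheory GRing.Theory Num.Theory.
Import numFieldNormedType.Exports.

Local Open Scope classical_set_scope.

(** * Norms and inner products *)

Section Norms.
Local Open Scope ring_scope.
Local Open Scope complex_scope.
Context {R : realType}.
Implicit Types (z : R[i]) (V : normedModType R[i]).

Lemma nrmN V (x : V) : nrm (- x) = nrm x.
Proof. by rewrite /nrm normrN. Qed.

Lemma nrm_distC V (x y : V) : nrm (x - y) = nrm (y - x).
Proof. by rewrite -nrmN opprB. Qed.

Lemma ler_nrm_dist V (x y z : V) : nrm (x - z) <= nrm (x - y) + nrm (y - z).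
Proof. by rewrite -{1}(subrK y x) -addrA ler_nrmD. Qed.

Lemma nrm_le_dist V (x y : V) : nrm x <= nrm y + nrm (x - y).
Proof. by rewrite -{1}(subrK y x) addrC ler_nrmD. Qed.

Lemma nrm_sum V I (r : seq I) (P : pred I) (F : I -> V) :
  nrm (\sum_(i <- r | P i) F i) <= \sum_(i <- r | P i) nrm (F i).
Proof.
elim/big_ind2 : _ => [|x a y b xa yb|//]; first by rewrite nrm0.
by rewrite (le_trans (ler_nrmD _ _))// lerD.
Qed.

Lemma nrmc_sqr z : nrm (z : R[i]^o) ^+ 2 = complex.Re z ^+ 2 + complex.Im z ^+ 2.
Proof.
by apply: (@complexI R); rewrite add_Re2_Im2 rmorphXn /=; congr (_ ^+ 2); exact: nrmE.
Qed.

Lemma nrmc_real (a : R) : nrm (a%:C : R[i]^o) = `|a|.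
Proof.
apply/eqP; rewrite -(@eqrXn2 _ 2)// ?nrm_ge0// nrmc_sqr/=.
by rewrite expr0n addr0 real_normK ?num_real.
Qed.

Lemma nrmcM z1 z2 : nrm (z1 * z2 : R[i]^o) = nrm (z1 : R[i]^o) * nrm (z2 : R[i]^o).
Proof. exact: (@nrmZ R R[i]^o). Qed.

Lemma ler_Re_nrm z : complex.Re z <= nrm (z : R[i]^o).
Proof.
rewrite (le_trans (ler_norm _))//.
rewrite -(@ler_pXn2r _ 2)// ?nnegrE ?nrm_ge0//.
by rewrite nrmc_sqr real_normK ?num_real// lerDl sqr_ge0.
Qed.

Lemma nrm_gt0 V (x : V) : x != 0 -> 0 < nrm x.
Proof.
by move=> x0; rewrite lt_def nrm_ge0 andbT; apply: contra x0 => /eqP/nrm0_eq0 ->.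
Qed.

Lemma nrm_normalize V (x : V) : x != 0 -> nrm ((nrm x)^-1%:C *: x) = 1.
Proof.
move=> x0; rewrite nrmZ nrmc_real ger0_norm ?invr_ge0 ?nrm_ge0// mulVf//.
by rewrite gt_eqF ?nrm_gt0.
Qed.

Lemma normalizeK V (x : V) : x = (nrm x)%:C *: ((nrm x)^-1%:C *: x).
Proof.
have [->|x0] := eqVneq x 0; first by rewrite !scaler0.
by rewrite scalerA -rmorphM mulfV ?scale1r// gt_eqF ?nrm_gt0.
Qed.

Lemma nrm_cvgP V (u : nat -> V) (l : V) : u n @[n --> \oo] --> l <->
  forall e : R, 0 < e -> exists N, forall n, (N <= n)%N -> nrm (u n - l) < e.
Proof.
split=> [/cvgrPdist_lt ul e e0|ul].
  have /ul [N _ NP] : (0 : R[i]) < e%:C by rewrite ltcR.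
  by exists N => n Nn; rewrite nrm_distC -ltcR nrmE; exact: NP.
apply/cvgrPdist_lt => -[a b]; rewrite ltcE/= => /andP[/eqP -> a0].
have [N NP] := ul _ a0; exists N => // n /= Nn.
by rewrite -nrmE ltcR nrm_distC NP.
Qed.

Lemma nrm_cauchy_cvg (V : completeNormedModType R[i]) (u : nat -> V) :
  (forall e : R, 0 < e -> exists N, forall n m, (N <= n)%N -> (N <= m)%N ->
    nrm (u n - u m) < e) -> cvgn u.
Proof.
move=> ucauchy; apply/cauchy_cvgP/cauchy_ballP => -[a b].
rewrite ltcE/= => /andP[/eqP -> a0].
have [N NP] := ucauchy _ a0; near_simpl.
exists ([set n | (N <= n)%N], [set n | (N <= n)%N]) => /=.
  by split; exists N.
move=> [n m] [/= Nn Nm]; rewrite -ball_normE /ball_/= -nrmE ltcR.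
exact: NP.
Qed.

Lemma nrm_cvg_unique V (u : nat -> V) l : u n @[n --> \oo] --> l -> limn u = l.
Proof. by move/cvg_lim; exact. Qed.

(** Positivity at x + y and at x + iy makes the form Hermitian; positivity at
    x - s(x, y) y then gives the bound, with no division by s(y, y). The lemma serves
    both for the inner product and for the form phi(b* a) of a state. *)
Lemma sesqui_cauchy_schwarz (V : lmodType R[i]) (s : V -> V -> R[i]) (x y : V) :
  (forall u a v w, s (u + a *: v) w = s u w + a * s v w) ->
  (forall u a v w, s w (u + a *: v) = s w u + a^*%C * s w v) ->
  (forall u, 0 <= s u u) -> complex.Re (s y y) <= 1 ->
  nrm (s x y : R[i]^o) ^+ 2 <= complex.Re (s x x).
Proof.
move=> sl sr s0 y1; rewrite nrmc_sqr.
move: (s0 x) (s0 y) (s0 (x + 1 *: y)) (s0 (x + 'i *: y))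
  (s0 (x + (- s x y) *: y)).
rewrite !(sl, sr); move: y1.
case: (s x x) (s y y) (s x y) (s y x) => [a a'] [b b'] [c c'] [d d'].
simpc => /= b1 /andP[/eqP a'0 a0] /andP[/eqP b'0 b0].
move=> /andP[/eqP H1 _] /andP[/eqP H2 _] /andP[/eqP H3 H4].
subst a' b'.
have e1 : d' = - c' by lra.
have e2 : d = c by lra.
subst d d'.
have : (c ^+ 2 + c' ^+ 2) * b <= (c ^+ 2 + c' ^+ 2) * 1.
  by rewrite ler_wpM2l// addr_ge0 ?sqr_ge0.
nra.
Qed.

End Norms.

Section HilbertTheory.
Local Open Scope ring_scope.
Local Open Scope complex_scope.
Context {R : realType} {H : hilbertType R}.
Implicit Types (x y z : H) (a : R[i]).

Lemma hdotC x y : hdot x y = (hdot y x)^*%C.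
Proof. by rewrite (hermC (@hdot R H)) expr0 mul1r. Qed.

Lemma hdotDl x y z : hdot (x + y) z = hdot x z + hdot y z.
Proof. exact: linearDl. Qed.

Lemma hdotDr x y z : hdot x (y + z) = hdot x y + hdot x z.
Proof. exact: linearDr. Qed.

Lemma hdotBl x y z : hdot (x - y) z = hdot x z - hdot y z.
Proof. exact: linearBl. Qed.

Lemma hdotBr x y z : hdot x (y - z) = hdot x y - hdot x z.
Proof. exact: linearBr. Qed.

Lemma hdotZl a x y : hdot (a *: x) y = a * hdot x y.
Proof. exact: linearZl_LR. Qed.

Lemma hdotZr a x y : hdot x (a *: y) = a^*%C * hdot x y.
Proof. exact: linearZr_LR. Qed.

Lemma hdot0l x : hdot 0 x = 0. Proof. exact: linear0l. Qed.
Lemma hdot0r x : hdot x 0 = 0. Proof. exact: linear0r. Qed.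

Lemma hdotxx x : hdot x x = (nrm x ^+ 2)%:C.
Proof. by rewrite hdot_norm -nrmE rmorphXn. Qed.

Lemma hdot_suml I (r : seq I) (P : pred I) (F : I -> H) y :
  hdot (\sum_(i <- r | P i) F i) y = \sum_(i <- r | P i) hdot (F i) y.
Proof. exact: linear_sumlz. Qed.

Lemma hdot_ext y z : (forall x, hdot x y = hdot x z) -> y = z.
Proof.
move=> yz; apply/eqP; rewrite -subr_eq0; apply/eqP/nrm0_eq0.
have := yz (y - z) => /eqP; rewrite -subr_eq0 -hdotBr hdotxx.
by move/eqP/(congr1 (@complex.Re R))/eqP; rewrite /= sqrf_eq0 => /eqP.
Qed.

Lemma hdot_cauchy_schwarz x y : nrm (hdot x y : R[i]^o) <= nrm x * nrm y.
Proof.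
have [->|y0] := eqVneq y 0; first by rewrite hdot0r !nrm0 mulr0.
rewrite {1}(normalizeK y) hdotZr nrmcM conjc_real nrmc_real ger0_norm ?nrm_ge0//.
rewrite mulrC ler_wpM2r ?nrm_ge0//.
rewrite -(@ler_pXn2r _ 2)// ?nnegrE ?nrm_ge0//.
have -> : nrm x ^+ 2 = complex.Re (hdot x x) by rewrite hdotxx.
apply: (@sesqui_cauchy_schwarz _ H (@hdot R H)).
- by move=> *; rewrite hdotDl hdotZl.
- by move=> *; rewrite hdotDr hdotZr.
- by move=> u; rewrite hdotxx lecR sqr_ge0.
- by rewrite hdotxx/= nrm_normalize// expr1n.
Qed.

Lemma Re_hdotC x y : complex.Re (hdot x y) = complex.Re (hdot y x).
Proof. by rewrite hdotC; case: (hdot y x). Qed.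

Lemma nrm_le_Re_hdot x (C : R) : 0 <= C ->
  (forall y, nrm y <= 1 -> complex.Re (hdot x y) <= C) -> nrm x <= C.
Proof.
move=> C0 xC; have [->|x0] := eqVneq x 0; first by rewrite nrm0.
have := xC ((nrm x)^-1%:C *: x).
rewrite nrm_normalize// hdotZr hdotxx conjc_real -rmorphM/= => /(_ (lexx _)).
by rewrite expr2 mulKf// gt_eqF// nrm_gt0.
Qed.

(** Riesz representation. A minimizing sequence (x_n) of |x|^2 - 2 Re f(x) satisfies
    |f(y) - <y, x_n>|^2 <= 1/(n+1) uniformly on the unit ball, as is seen by moving x_n
    in the direction of y; this makes (x_n) Cauchy and identifies its limit. *)
Lemma riesz (f : H -> R[i]) (C : R) :
  (forall x a y, f (x + a *: y) = f x + a * f y) ->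
  (forall x, nrm (f x : R[i]^o) <= C * nrm x) ->
  exists z, forall x, f x = hdot x z.
Proof.
move=> fl fC.
pose J x := nrm x ^+ 2 - 2 * complex.Re (f x).
have Jinf : has_inf (range J).
  split; first by exists (J 0), 0.
  exists (- C ^+ 2) => _ [x _ <-]; rewrite /J.
  have := le_trans (ler_Re_nrm (f x)) (fC x).
  by have := sqr_ge0 (nrm x - C); rewrite sqrrB; nra.
pose m := inf (range J).
have Jm x : m <= J x by apply: inf_lbound; [case: Jinf|exists x].
have Jx n : {x | J x < m + n.+1%:R^-1}.
  apply/cid; have [|_ [x _ <-] xm] := @inf_adherent _ _ n.+1%:R^-1 _ Jinf; last by exists x.
  by rewrite invr_gt0.
pose x n := sval (Jx n).
have xP n : J (x n) < m + n.+1%:R^-1 := svalP (Jx n).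
have near_rep n y : nrm y <= 1 ->
    nrm (f y - hdot y (x n) : R[i]^o) ^+ 2 <= n.+1%:R^-1.
  move=> y1.
  (* With z = f(y) - <y, x_n>, J(x_n + conj(z) y) = J(x_n) - 2 |z|^2 + |z|^2 |y|^2. *)
  have := Jm (x n + (f y - hdot y (x n))^*%C *: y).
  have := xP n; move: (n.+1%:R^-1) => e.
  rewrite /J.
  have sq (u : H) : nrm u ^+ 2 = complex.Re (hdot u u) by rewrite hdotxx.
  rewrite !sq hdotDl !hdotDr !hdotZl !hdotZr fl nrmc_sqr (hdotC (x n) y).
  have -> : hdot y y = (nrm y ^+ 2)%:C by rewrite hdotxx.
  rewrite hdotxx.
  have : nrm y ^+ 2 <= 1 by rewrite expr_le1// nrm_ge0.
  have : 0 <= nrm y ^+ 2 by rewrite sqr_ge0.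
  move: (nrm y ^+ 2) (nrm (x n) ^+ 2) => ny nx.
  case: (f y) (f (x n)) (hdot y (x n)) => [a a'] [b b'] [c c'].
  simpc => /= ny0 ny1 H1 H2.
  have : ((a - c) ^+ 2 + (a' - c') ^+ 2) * ny <= ((a - c) ^+ 2 + (a' - c') ^+ 2) * 1.
    by rewrite ler_wpM2l// addr_ge0 ?sqr_ge0.
  nra.
have near_rep_nrm n (e : R) y : 0 < e -> e ^- 2 <= n.+1%:R ->
    nrm (f y - hdot y (x n) : R[i]^o) <= e * nrm y.
  move=> e0 en; have [->|y0] := eqVneq y 0.
    have -> : f 0 = 0 by have := fl 0 (-1) 0; rewrite scaler0 addr0 mulN1r subrr.
    by rewrite hdot0l subrr !nrm0 mulr0.
  have f0 : f 0 = 0 by have := fl 0 (-1) 0; rewrite scaler0 addr0 mulN1r subrr.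
  rewrite {1 2}(normalizeK y) hdotZl -{1}[_ *: _]add0r fl f0 add0r.
  rewrite -mulrBr nrmcM nrmc_real ger0_norm ?nrm_ge0// mulrC ler_wpM2r ?nrm_ge0//.
  rewrite -(@ler_pXn2r _ 2)// ?nnegrE ?nrm_ge0 ?(ltW e0)//.
  rewrite (le_trans (near_rep _ _ _))// ?nrm_normalize//.
  by rewrite -[leRHS]invrK lef_pV2// ?posrE// invr_gt0 exprn_gt0.
have exN (e : R) : 0 < e -> exists N, forall n, (N <= n)%N -> e ^- 2 <= n.+1%:R.
  move=> e0; exists (Num.truncn (e ^- 2)) => n Nn.
  rewrite (le_trans (ltW (truncnS_gt _)))// ler_nat ltnS//.
have /cvg_ex[z /= xz] : cvgn x.
  apply: nrm_cauchy_cvg => e e0.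
  have [|N NP] := exN (e / 3); first by rewrite divr_gt0.
  exists N => n k Nn Nk; apply: (@le_lt_trans _ _ (e / 3 + e / 3)); last by lra.
  apply: nrm_le_Re_hdot => [|y y1]; first by lra.
  rewrite Re_hdotC (le_trans (ler_Re_nrm _))// hdotBr.
  rewrite (le_trans (@ler_nrm_dist _ R[i]^o _ (f y) _))//.
  have e3 : 0 < e / 3 by rewrite divr_gt0.
  have close i : (N <= i)%N -> nrm (f y - hdot y (x i) : R[i]^o) <= e / 3.
    move=> Ni; rewrite (le_trans (near_rep_nrm _ _ _ e3 (NP _ Ni)))//.
    by rewrite ler_piMr// ltW.
  by apply: lerD; [rewrite (@nrm_distC _ R[i]^o)|]; exact: close.
exists z => y; apply/eqP; rewrite -subr_eq0; apply/eqP/(@nrm0_eq0 R R[i]^o)/eqP.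
rewrite eq_le nrm_ge0 andbT; apply/ler_addgt0Pr => e e0; rewrite add0r.
pose d := e / (2 * (nrm y + 1)).
have d0 : 0 < d by rewrite divr_gt0// mulr_gt0// ltr_wpDl// nrm_ge0.
have [N NP] := exN _ d0; have [M MP] := (nrm_cvgP _ _).1 xz _ d0.
rewrite (le_trans (@ler_nrm_dist _ R[i]^o _ (hdot y (x (maxn N M))) _))//.
apply: (@le_trans _ _ (d * nrm y + nrm y * d)).
  rewrite lerD ?near_rep_nrm ?NP ?leq_maxl// -hdotBr.
  rewrite (le_trans (hdot_cauchy_schwarz _ _))// ler_wpM2l ?nrm_ge0//.
  by rewrite ltW// MP// leq_maxr.
have ny := nrm_ge0 y.
rewrite mulrC -mulrDr -mulr2n -mulr_natr.
have -> : e = (nrm y + 1) * (d * 2).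
  by rewrite /d; field; rewrite gt_eqF//; lra.
by rewrite ler_wpM2r ?lerDl// mulr_ge0// ltW.
Qed.

End HilbertTheory.

(** * Bounded operators *)

Section Operators.
Local Open Scope ring_scope.
Local Open Scope complex_scope.
Context {R : realType} {H : hilbertType R}.
Implicit Types (a b c T : bop H) (v w : H).

Lemma bopME a b v : (a * b) v = a (b v). Proof. by []. Qed.
Lemma bopNE a v : (- a) v = - a v. Proof. by []. Qed.
Lemma bopBE a b v : (a - b) v = a v - b v. Proof. by []. Qed.

Lemma seqDE (x y : nat -> bop H) j : (x + y) j = x j + y j. Proof. by []. Qed.
Lemma seqNE (x : nat -> bop H) j : (- x) j = - x j. Proof. by []. Qed.
Lemma seqBE (x y : nat -> bop H) j : (x - y) j = x j - y j. Proof. by []. Qed.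

Lemma bop_sumE I (r : seq I) (P : pred I) (F : I -> bop H) v :
  (\sum_(i <- r | P i) F i) v = \sum_(i <- r | P i) F i v.
Proof. by elim/big_rec2 : _ => // i x y _ <-. Qed.

Lemma bop_mulZl (z : R[i]) a b : (z *: a) * b = z *: (a * b).
Proof. exact: bopext. Qed.

Lemma bop_mulZr (z : R[i]) a b : a * (z *: b) = z *: (a * b).
Proof. by apply: bopext => v; rewrite bopME !bopZE linearZ. Qed.

Lemma nrm_bop_apply T v : nrm (T v) <= nrm T * nrm v.
Proof.
have [->|v0] := eqVneq v 0; first by rewrite linear0 !nrm0 mulr0.
rewrite {1}(normalizeK v) linearZ nrmZ nrmc_real ger0_norm ?nrm_ge0// mulrC.
by rewrite ler_wpM2r ?nrm_ge0// opnorm_ub// nrm_normalize.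
Qed.

Lemma nrm_bop_le T (C : R) :
  (forall v, nrm v <= 1 -> nrm (T v) <= C) -> nrm T <= C.
Proof. exact: opnorm_le. Qed.

Lemma nrm_bop_le_mul T (C : R) : 0 <= C ->
  (forall v, nrm (T v) <= C * nrm v) -> nrm T <= C.
Proof.
by move=> C0 TC; apply: nrm_bop_le => v v1; rewrite (le_trans (TC v))// ler_piMr.
Qed.

Lemma nrm_bopM a b : nrm (a * b) <= nrm a * nrm b.
Proof.
apply: nrm_bop_le_mul => [|v]; first by rewrite mulr_ge0 ?nrm_ge0.
rewrite bopME (le_trans (nrm_bop_apply _ _))// -mulrA ler_wpM2l ?nrm_ge0//.
exact: nrm_bop_apply.
Qed.

Lemma adj_ex a : exists b, forall v w, hdot (a v) w = hdot v (b w).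
Proof.
have rep w : {z | forall v, hdot (a v) w = hdot v z}.
  apply/cid; apply: (@riesz _ _ (fun v => hdot (a v) w) (nrm a * nrm w)).
    by move=> x z y; rewrite linearD linearZ hdotDl hdotZl.
  move=> x; rewrite (le_trans (hdot_cauchy_schwarz _ _))// mulrAC.
  by rewrite ler_wpM2r ?nrm_ge0 ?nrm_bop_apply.
pose b w := sval (rep w).
have bP w v : hdot (a v) w = hdot v (b w) := svalP (rep w) v.
suff b_bl : b \in @bounded_linear _ H by exists (Bop b_bl) => v w; exact: bP.
apply/bounded_linearP; split.
  move=> z x y; apply: hdot_ext => v.
  by rewrite -bP !hdotDr !hdotZr !bP.
exists (nrm a) => w; apply: nrm_le_Re_hdot => [|y y1].
  by rewrite mulr_ge0 ?nrm_ge0.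
rewrite Re_hdotC -bP (le_trans (ler_Re_nrm _))//.
rewrite (le_trans (hdot_cauchy_schwarz _ _))// ler_wpM2r ?nrm_ge0//.
by rewrite (le_trans (nrm_bop_apply _ _))// ler_piMr ?nrm_ge0.
Qed.

Lemma hdot_adjr a v w : hdot (a v) w = hdot v (adj a w).
Proof. by have := xgetPex 0 (adj_ex a); exact. Qed.

Lemma hdot_adjl a v w : hdot (adj a v) w = hdot v (a w).
Proof. by rewrite hdotC -hdot_adjr -hdotC. Qed.

Lemma adj_unique a b : (forall v w, hdot (a v) w = hdot v (b w)) -> adj a = b.
Proof.
by move=> ab; apply: bopext => w; apply: hdot_ext => v; rewrite -hdot_adjr ab.
Qed.

Lemma adjD a b : adj (a + b) = adj a + adj b.
Proof.
by apply: adj_unique => v w; rewrite !bopDE hdotDl hdotDr -!hdot_adjr.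
Qed.

Lemma adjZ (z : R[i]) a : adj (z *: a) = z^*%C *: adj a.
Proof.
by apply: adj_unique => v w; rewrite !bopZE hdotZl hdotZr conjcK -!hdot_adjr.
Qed.

Lemma adj1 : adj 1 = 1 :> bop H.
Proof. exact: adj_unique. Qed.

Lemma adj0 : adj 0 = 0 :> bop H.
Proof. by apply: adj_unique => v w; rewrite hdot0l hdot0r. Qed.

(** The limit is taken pointwise; the Cauchy estimates are uniform on the unit ball, so
    they pass to the limit and give convergence for the operator norm. *)
Lemma bop_complete (u : nat -> bop H) :
  (forall e : R, 0 < e -> exists N, forall n m, (N <= n)%N -> (N <= m)%N ->
    nrm (u n - u m) < e) -> cvgn u.
Proof.
move=> uC.
have ptw v : cvgn (fun n => u n v).
  apply: nrm_cauchy_cvg => e e0.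
  have nv := nrm_ge0 v.
  have [|N NP] := uC (e / (nrm v + 1)); first by rewrite divr_gt0// ltr_wpDl.
  exists N => n m Nn Nm; have := nrm_bop_apply (u n - u m) v.
  rewrite bopBE => /le_lt_trans; apply.
  apply: (@le_lt_trans _ _ (e / (nrm v + 1) * nrm v)).
    by rewrite ler_wpM2r// ltW// NP.
  by rewrite mulrAC ltr_pdivrMr ?ltr_wpDl// ltr_pM2l// ltrDl.
pose L v := limn (fun n => u n v).
have uL v : u n v @[n --> \oo] --> L v := ptw v.
have bnd (e : R) : 0 < e -> exists N, forall n, (N <= n)%N -> forall v,
    nrm (u n v - L v) <= e * nrm v.
  move=> e0; have [N NP] := uC _ e0; exists N => n Nn v.
  apply/ler_addgt0Pr => d d0.
  have [M MP] := (nrm_cvgP _ _).1 (uL v) _ d0.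
  rewrite (le_trans (ler_nrm_dist _ (u (maxn N M) v) _))// lerD//.
    rewrite (le_trans (nrm_bop_apply (u n - u (maxn N M)) v))//.
    by rewrite ler_wpM2r ?nrm_ge0// ltW// NP// leq_maxl.
  by rewrite ltW// MP// leq_maxr.
have Llin : linear L.
  move=> z v w; rewrite /L; apply: nrm_cvg_unique.
  under eq_fun do rewrite linearD linearZ/=.
  by apply: cvgD; [apply: cvgZr; exact: uL|exact: uL].
have [N0 N0P] := bnd 1 ltr01.
have Lb : L \in @bounded_linear _ H.
  apply/bounded_linearP; split => //; exists (nrm (u N0) + 1) => v.
  rewrite (le_trans (nrm_le_dist _ (u N0 v)))// mulrDl lerD ?nrm_bop_apply//.
  by rewrite nrm_distC N0P.
apply/cvg_ex; exists (Bop Lb); apply/nrm_cvgP => e e0.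
have e2 : 0 < e / 2 by rewrite divr_gt0.
have [N NP] := bnd _ e2; exists N => n Nn.
apply: (@le_lt_trans _ _ (e / 2)); last by lra.
by apply: nrm_bop_le_mul => [|v]; [exact: ltW|exact: NP].
Qed.

End Operators.

(** * The standard module *)

Section StandardModuleTheory.
Local Open Scope ring_scope.
Local Open Scope complex_scope.
Context {R : realType} {H : hilbertType R}.
Implicit Types (x y : nat -> bop H) (v w : H) (n m : nat).

Definition gram x n m : bop H := \sum_(n <= j < m) adj (x j) * x j.

Definition sqsum x n m v : R := \sum_(n <= j < m) nrm (x j v) ^+ 2.

Lemma hdot_gram x n m v w :
  hdot (gram x n m v) w = \sum_(n <= j < m) hdot (x j v) (x j w).
Proof.
rewrite /gram bop_sumE hdot_suml; apply: eq_bigr => j _.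
by rewrite bopME hdot_adjl.
Qed.

Lemma hdot_gramxx x n m v : hdot (gram x n m v) v = (sqsum x n m v)%:C.
Proof.
by rewrite hdot_gram /sqsum rmorph_sum/=; apply: eq_bigr => j _; rewrite hdotxx.
Qed.

Lemma sqsum_ge0 x n m v : 0 <= sqsum x n m v.
Proof. by apply: sumr_ge0 => j _; exact: sqr_ge0. Qed.

Lemma sqsum_le_gram x n m v : nrm v <= 1 -> sqsum x n m v <= nrm (gram x n m).
Proof.
move=> v1; have -> : sqsum x n m v = complex.Re (hdot (gram x n m v) v).
  by rewrite hdot_gramxx.
rewrite (le_trans (ler_Re_nrm _))// (le_trans (hdot_cauchy_schwarz _ _))//.
rewrite (le_trans (ler_wpM2l (nrm_ge0 _) v1))// mulr1.
by rewrite (le_trans (nrm_bop_apply _ _))// ler_piMr// nrm_ge0.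
Qed.

Lemma Re_sum I (r : seq I) (P : pred I) (F : I -> R[i]) :
  complex.Re (\sum_(i <- r | P i) F i) = \sum_(i <- r | P i) complex.Re (F i).
Proof. by elim/big_rec2 : _ => // i a z _ <-; case: (F i) z => ? ? []. Qed.

(** For a positive operator the supremum of the quadratic form on the unit ball is the
    operator norm, since 2 Re <x_j v, x_j w> <= |x_j v|^2 + |x_j w|^2. *)
Lemma nrm_gram_le x n m (C : R) :
  (forall v, nrm v <= 1 -> sqsum x n m v <= C) -> nrm (gram x n m) <= C.
Proof.
move=> xC; have C0 : 0 <= C.
  by rewrite (le_trans (sqsum_ge0 x n m 0))// xC// nrm0.
apply: nrm_bop_le => v v1; apply: nrm_le_Re_hdot => // w w1.
rewrite hdot_gram Re_sum -(@ler_pM2l _ 2)//.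
apply: (@le_trans _ _ (sqsum x n m v + sqsum x n m w)); last first.
  by rewrite mulr2n mulrDl mul1r lerD ?xC.
rewrite /sqsum -big_split/= mulr_sumr; apply: ler_sum => j _.
have : 0 <= complex.Re (hdot (x j v - x j w) (x j v - x j w)).
  by rewrite hdotxx/= sqr_ge0.
rewrite hdotBl !hdotBr !hdotxx (hdotC (x j w)).
by case: (hdot (x j v)) => a b; simpc => /=; lra.
Qed.

Lemma series_gram x n : series (fun j => adj (x j) * x j) n = gram x 0 n.
Proof. by []. Qed.

Lemma sqsum_cat x k n m v : (n <= k)%N -> (k <= m)%N ->
  sqsum x n m v = sqsum x n k v + sqsum x k m v.
Proof. by move=> nk km; rewrite /sqsum (big_cat_nat nk). Qed.

Lemma sqsum_le0n x n m v : sqsum x n m v <= sqsum x 0 m v.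
Proof.
have [nm|mn] := leqP n m; first by rewrite (@sqsum_cat x n 0)// lerDr sqsum_ge0.
by rewrite {1}/sqsum big_geq ?sqsum_ge0// ltnW.
Qed.

Lemma sqsum_leqr x n m k v : (m <= k)%N -> sqsum x n m v <= sqsum x n k v.
Proof.
move=> mk; have [nm|mn] := leqP n m.
  by rewrite (@sqsum_cat x m n k)// lerDl sqsum_ge0.
by rewrite {1}/sqsum big_geq ?sqsum_ge0// ltnW.
Qed.

(** Norm convergence of the partial Gram sums is a Cauchy condition on their quadratic
    forms, uniform on the unit ball. Estimates in the module can therefore be made one
    vector at a time, as in a sequence space over H. *)
Lemma l2P x : l2 x <-> forall e : R, 0 < e ->
  exists N, forall n m v, (N <= n)%N -> nrm v <= 1 -> sqsum x n m v <= e.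
Proof.
split=> [/cvg_ex[T /nrm_cvgP xT] e e0|xe].
  have [|N NP] := xT (e / 2); first by rewrite divr_gt0.
  exists N => n m v Nn v1; have [nm|mn] := leqP n m; last first.
    by rewrite /sqsum big_geq ?(ltnW mn)// ltW.
  rewrite (le_trans (sqsum_le_gram _ _ _ v1))//.
  rewrite /gram -(sub_series_geq _ nm) (le_trans (ler_nrm_dist _ T _))//.
  have := NP _ Nn; have := NP _ (leq_trans Nn nm).
  by rewrite (@nrm_distC _ _ (series _ n)); lra.
apply: bop_complete => e e0.
have [|N NP] := xe (e / 2); first by rewrite divr_gt0.
have close n m : (N <= n)%N -> (n <= m)%N ->
    nrm (series (fun j => adj (x j) * x j) m - series (fun j => adj (x j) * x j) n)
      < e.
  move=> Nn nm; rewrite sub_series_geq//.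
  apply: (@le_lt_trans _ _ (e / 2)); last by lra.
  by apply: nrm_gram_le => v v1; exact: NP.
exists N => n m Nn Nm; have [nm|mn] := leqP n m; last exact/close/ltnW.
by rewrite nrm_distC close.
Qed.

Lemma l2norm_ge0 x : 0 <= l2norm x.
Proof. exact: sqrtr_ge0. Qed.

Lemma l2norm_sqr x : l2norm x ^+ 2 = nrm (l2dot x x).
Proof. by rewrite sqr_sqrtr ?nrm_ge0. Qed.

Lemma sqsum_le_l2norm x n m v : l2 x -> nrm v <= 1 -> sqsum x n m v <= l2norm x ^+ 2.
Proof.
move=> xl v1; rewrite (le_trans (sqsum_le0n _ _ _ _))// l2norm_sqr.
apply/ler_addgt0Pr => e e0.
have [N NP] := (nrm_cvgP _ _).1 (xl : series _ n @[n --> \oo] --> l2dot x x) _ e0.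
rewrite (le_trans (sqsum_leqr _ _ _ (leq_maxl m N)))//.
rewrite (le_trans (sqsum_le_gram _ _ _ v1))//.
rewrite (le_trans (nrm_le_dist _ (l2dot x x)))// lerD//.
by rewrite -series_gram ltW// NP// leq_maxr.
Qed.

Lemma l2norm_le x (C : R) : l2 x -> 0 <= C ->
  (forall m v, nrm v <= 1 -> sqsum x 0 m v <= C ^+ 2) -> l2norm x <= C.
Proof.
move=> xl C0 xC; rewrite -(@ler_pXn2r _ 2)// ?nnegrE ?l2norm_ge0// l2norm_sqr.
apply/ler_addgt0Pr => e e0.
have [N NP] := (nrm_cvgP _ _).1 (xl : series _ n @[n --> \oo] --> l2dot x x) _ e0.
rewrite (le_trans (nrm_le_dist _ (gram x 0 N)))// lerD//.
  by apply: nrm_gram_le => v v1; exact: xC.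
by rewrite nrm_distC -series_gram ltW// NP.
Qed.

Lemma sqsumN x n m v : sqsum (- x) n m v = sqsum x n m v.
Proof. by apply: eq_bigr => j _; rewrite seqNE bopNE nrmN. Qed.

Lemma sqsumD_le x y n m v :
  sqsum (x + y) n m v <= 2 * sqsum x n m v + 2 * sqsum y n m v.
Proof.
rewrite /sqsum !mulr_sumr -big_split/=; apply: ler_sum => j _.
have : nrm ((x + y) j v) ^+ 2 <= (nrm (x j v) + nrm (y j v)) ^+ 2.
  by rewrite ler_pXn2r// ?nnegrE ?addr_ge0 ?nrm_ge0// ler_nrmD.
rewrite seqDE bopDE.
by have := sqr_ge0 (nrm (x j v) - nrm (y j v)); nra.
Qed.

Lemma l2_add x y : l2 x -> l2 y -> l2 (x + y).
Proof.
move=> /l2P xl /l2P yl; apply/l2P => e e0.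
have e4 : 0 < e / 4 by rewrite divr_gt0.
have [N NP] := xl _ e4; have [M MP] := yl _ e4.
exists (maxn N M) => n m v; rewrite geq_max => /andP[Nn Mn] v1.
rewrite (le_trans (sqsumD_le _ _ _ _ _))//.
by have := NP n m v Nn v1; have := MP n m v Mn v1; lra.
Qed.

Lemma l2_opp x : l2 x -> l2 (- x).
Proof.
by move=> /l2P xl; apply/l2P => e /xl[N NP]; exists N => n m v; rewrite sqsumN; exact: NP.
Qed.

Lemma l2_sub x y : l2 x -> l2 y -> l2 (x - y).
Proof. by move=> xl yl; apply: l2_add => //; exact: l2_opp. Qed.

Definition finitely_supported n x := forall j, (n <= j)%N -> x j = 0.

Lemma sqsum_supp n x k m v : finitely_supported n x -> (n <= k)%N -> sqsum x k m v = 0.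
Proof.
move=> xn nk; rewrite /sqsum big_nat_cond big1// => j /andP[/andP[kj _] _].
by rewrite xn ?(leq_trans nk)// nrm0 expr0n.
Qed.

Lemma l2_supp n x : finitely_supported n x -> l2 x.
Proof.
move=> xn; apply/l2P => e e0; exists n => k m v nk v1.
by rewrite (sqsum_supp _ _ xn)// ltW.
Qed.

Lemma l2_0 : l2 (0 : nat -> bop H).
Proof. exact: (@l2_supp 0). Qed.

Lemma sqsum_scale x n m v (C : R) : 0 <= C ->
  (forall w, nrm w = 1 -> sqsum x n m w <= C) -> sqsum x n m v <= C * nrm v ^+ 2.
Proof.
move=> C0 xC; have [->|v0] := eqVneq v 0.
  rewrite nrm0 expr0n mulr0 /sqsum big1// => j _.
  by rewrite linear0 nrm0 expr0n.
have -> : sqsum x n m v = nrm v ^+ 2 * sqsum x n m ((nrm v)^-1%:C *: v).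
  rewrite /sqsum mulr_sumr; apply: eq_bigr => j _.
  by rewrite {1}(normalizeK v) linearZ nrmZ exprMn nrmc_real ger0_norm ?nrm_ge0.
by rewrite mulrC ler_wpM2r ?sqr_ge0// xC// nrm_normalize.
Qed.

Lemma sqsum_act x a n m v : sqsum (l2act x a) n m v = sqsum x n m (a v).
Proof. by []. Qed.

End StandardModuleTheory.

(** * The semi-norms and the measures of noncompactness *)

Section SeminormTheory.
Local Open Scope ring_scope.
Local Open Scope complex_scope.
Context {R : realType} {H : hilbertType R}.
Implicit Types (x y z : nat -> bop H) (phi : {linear bop H -> R[i]^o}).

(** The cross terms satisfy 2 a b <= (s / r) a^2 + (r / s) b^2. *)
Lemma minkowski_sum (n m : nat) (a b c : nat -> R) (r s : R) :
  (forall j, (n <= j < m)%N -> 0 <= c j <= a j + b j) -> 0 < r -> 0 < s ->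
  \sum_(n <= j < m) a j ^+ 2 <= r ^+ 2 -> \sum_(n <= j < m) b j ^+ 2 <= s ^+ 2 ->
  \sum_(n <= j < m) c j ^+ 2 <= (r + s) ^+ 2.
Proof.
move=> cab r0 s0 ar bs.
apply: (@le_trans _ _ (\sum_(n <= j < m)
    ((1 + s / r) * a j ^+ 2 + (1 + r / s) * b j ^+ 2))).
  apply: ler_sum_nat => j /cab/andP[c0 cj].
  apply: (@le_trans _ _ ((a j + b j) ^+ 2)).
    by rewrite ler_pXn2r// nnegrE// (le_trans c0).
  rewrite -subr_ge0.
  suff -> : (1 + s / r) * a j ^+ 2 + (1 + r / s) * b j ^+ 2 - (a j + b j) ^+ 2 =
      (s * a j - r * b j) ^+ 2 / (r * s).
    by rewrite divr_ge0 ?sqr_ge0// mulr_ge0// ltW.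
  by field; rewrite !gt_eqF.
rewrite big_split/= -!mulr_sumr.
have -> : (r + s) ^+ 2 = (1 + s / r) * r ^+ 2 + (1 + r / s) * s ^+ 2.
  by field; rewrite !gt_eqF.
by rewrite lerD// ler_wpM2l// addr_ge0// divr_ge0// ltW.
Qed.

Definition coef phi y x j : R := nrm (phi (adj (y j) * x j)).

Lemma seminorm_leP phi y x (r : R) : 0 <= r ->
  (seminorm phi y x <= r%:E)%E <->
  forall n, \sum_(0 <= j < n) coef phi y x j ^+ 2 <= r ^+ 2.
Proof.
move=> r0; rewrite /seminorm.
have -> : r%:E = sqrte (r ^+ 2)%:E by rewrite /= sqrtr_sqr ger0_norm.
rewrite lee_sqrt ?lee_fin ?sqr_ge0//; split=> [xr n|xr].
  rewrite -lee_fin -sumEFin (le_trans _ xr)//.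
  by apply: nneseries_lim_ge => j _ _; rewrite lee_fin sqr_ge0.
apply: lime_le; first by apply: is_cvg_nneseries => j _ _; rewrite lee_fin sqr_ge0.
by apply: nearW => n; rewrite sumEFin lee_fin xr.
Qed.

Lemma seminorm_ltP phi y x (e : R) : (seminorm phi y x < e%:E)%E ->
  exists2 r, 0 < r < e & (seminorm phi y x <= r%:E)%E.
Proof.
have := @sqrte_ge0 _ (\sum_(0 <= j <oo) (coef phi y x j ^+ 2)%:E)%E.
rewrite -/(seminorm phi y x); case: (seminorm phi y x) => [t| |]//.
rewrite lee_fin lte_fin => t0 te; exists ((t + e) / 2).
  by apply/andP; split; lra.
by rewrite lee_fin; lra.
Qed.

Lemma seminormN phi y x : seminorm phi y (- x) = seminorm phi y x.
Proof.
congr sqrte; apply: eq_eseriesr => j _; congr ((_ ^+ 2)%:E).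
have -> : adj (y j) * (- x) j = - (adj (y j) * x j) by rewrite -mulrN.
by rewrite linearN nrmN.
Qed.

Lemma seminorm_subC phi y x z : seminorm phi y (x - z) = seminorm phi y (z - x).
Proof. by rewrite -seminormN opprB. Qed.

Lemma coefD phi y x z j : coef phi y (x + z) j <= coef phi y x j + coef phi y z j.
Proof.
rewrite /coef; have -> : adj (y j) * (x + z) j = adj (y j) * x j + adj (y j) * z j.
  by rewrite -mulrDr.
by rewrite linearD ler_nrmD.
Qed.

Lemma seminormD_lt phi y x z (e f : R) :
  (seminorm phi y x < e%:E -> seminorm phi y z < f%:E ->
   seminorm phi y (x + z)%R < (e + f)%:E)%E.
Proof.
move=> /seminorm_ltP[r /andP[r0 re]] /(seminorm_leP _ _ _ (ltW r0)) xr.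
move=> /seminorm_ltP[s /andP[s0 sf]] /(seminorm_leP _ _ _ (ltW s0)) zs.
apply: (@le_lt_trans _ _ (r + s)%:E); last by rewrite lte_fin ltrD.
apply/seminorm_leP => [|n]; first by rewrite addr_ge0 ?ltW.
apply: (minkowski_sum _ r0 s0 (xr n) (zs n)) => j _.
by rewrite nrm_ge0 coefD.
Qed.

Lemma seminorm_lt_dist phi y x z u (e f : R) :
  (seminorm phi y (x - z)%R < e%:E -> seminorm phi y (z - u)%R < f%:E ->
   seminorm phi y (x - u)%R < (e + f)%:E)%E.
Proof. by move=> xz zu; rewrite -(subrK z x) -addrA; exact: seminormD_lt. Qed.

End SeminormTheory.

Section Measures.
Local Open Scope ring_scope.
Local Open Scope ereal_scope.
Context {R : realType} {H : hilbertType R}.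
Implicit Types (E : set (nat -> bop H)) (p : (nat -> bop H) -> \bar R).

Lemma esup0_ge0 (S : set (\bar R)) : 0 <= esup0 S.
Proof. by apply: ereal_sup_ubound; left. Qed.

Lemma esup0_ub (S : set (\bar R)) a : S a -> a <= esup0 S.
Proof. by move=> Sa; apply: ereal_sup_ubound; right. Qed.

Lemma esup0_le (S : set (\bar R)) b : 0 <= b -> (forall a, S a -> a <= b) -> esup0 S <= b.
Proof. by move=> b0 Sb; apply: ge_ereal_sup => a [->|/Sb]. Qed.

Lemma alpha_ge0 E p : 0 <= alpha E p.
Proof. by apply: le_ereal_inf_tmp => _ [e [e0 _] <-]; rewrite lee_fin ltW. Qed.

(** Pigeonhole: a set of small diameter contains at most one point of a separated set. *)
Lemma istratescu_le_alpha E p : istratescu E p <= alpha E p.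
Proof.
apply: esup0_le => [|_ [e [e0 [S [SE Sinf Ssep]]] <-]]; first exact: alpha_ge0.
apply: le_ereal_inf_tmp => _ [d [d0 [n [T [ET Tsmall]]]] <-].
rewrite leNgt; apply/negP => de; apply: Sinf.
apply: (@sub_finite_set _ _ (\bigcup_i (S `&` T i))).
  by move=> x Sx; have := SE _ Sx; rewrite ET => -[i _ Tx]; exists i.
apply: bigcup_finite => // i _.
have [->|/set0P[x [Sx Tx]]] := eqVneq (S `&` T i) set0; first exact: finite_set0.
apply: (sub_finite_set _ (finite_set1 x)) => z [Sz Tz]; apply: contrapT => zx.
have := le_lt_trans (Ssep _ _ Sz Sx zx) (Tsmall _ _ _ Tz Tx).
by rewrite ltNge (ltW de).
Qed.

Lemma alpha_le_chi E phi y :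
  alpha E (seminorm phi y) <= 2%:E * chi E (seminorm phi y).
Proof.
rewrite -lee_pdivrMl//; apply: le_ereal_inf_tmp => _ [e [e0 [n [c [_ Ec]]]] <-].
rewrite lee_pdivrMl//; apply: ereal_inf_lbound; exists (2 * e)%R => //; split.
  by rewrite mulr_gt0.
exists n, (fun i => E `&` [set z | seminorm phi y (z - c i)%R < e%:E]); split.
  apply/seteqP; split=> [x Ex|x [i _ []]//].
  by have [i _ xi] := Ec _ Ex; exists i.
move=> i x z [_ xi] [_ zi]; rewrite mulr2n mulrDl mul1r.
by apply: (seminorm_lt_dist xi); rewrite seminorm_subC.
Qed.

Lemma star_le (mu nu : set (nat -> bop H) -> ((nat -> bop H) -> \bar R) -> \bar R) E
    (k : \bar R) : 0 <= k ->
  (forall p, seminorms p -> mu E p <= k * nu E p) -> star mu E <= k * star nu E.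
Proof.
move=> k0 munu; apply: esup0_le => [|_ [p pP <-]]; first by rewrite mule_ge0 ?esup0_ge0.
by rewrite (le_trans (munu _ pP))// lee_wpmul2l// esup0_ub//; exists p.
Qed.

Lemma star_istratescu_le_alpha E : star (@istratescu R H) E <= star (@alpha R H) E.
Proof.
rewrite -[leRHS]mul1e; apply: star_le => // p _.
by rewrite mul1e istratescu_le_alpha.
Qed.

Lemma star_alpha_le_chi E : star (@alpha R H) E <= 2%:E * star (@chi R H) E.
Proof. by apply: star_le => // p [phi [y [_ _ ->]]]; exact: alpha_le_chi. Qed.

End Measures.

(** * Normal states *)

Section States.
Local Open Scope ring_scope.
Local Open Scope complex_scope.
Context {R : realType} {H : hilbertType R}.
Implicit Types (x y : nat -> bop H) (phi : {linear bop H -> R[i]^o}) (a b : bop H).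

Lemma nrm_adj_le a : nrm (adj a) <= nrm a.
Proof.
apply: nrm_bop_le => w w1; apply: nrm_le_Re_hdot => [|v v1]; first exact: nrm_ge0.
rewrite hdot_adjl (le_trans (ler_Re_nrm _))// (le_trans (hdot_cauchy_schwarz _ _))//.
rewrite (le_trans (ler_wpM2r (nrm_ge0 _) w1))// mul1r.
by rewrite (le_trans (nrm_bop_apply _ _))// ler_piMr// nrm_ge0.
Qed.

Lemma state_cauchy_schwarz phi a b : (forall c, (0 : R[i]) <= phi (adj c * c)) ->
  complex.Re (phi (adj b * b)) <= 1 ->
  nrm (phi (adj b * a)) ^+ 2 <= complex.Re (phi (adj a * a)).
Proof.
move=> phi0 b1.
apply: (@sesqui_cauchy_schwarz _ (bop H) (fun a b => phi (adj b * a))) => //.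
- by move=> u z v w; rewrite mulrDr bop_mulZr linearD linearZ.
- by move=> u z v w; rewrite adjD adjZ mulrDl bop_mulZl linearD linearZ.
Qed.

Lemma sigma_weak_seminorm_le (h g : nat -> H) : sqsummable h -> sqsummable g ->
  exists C : R, forall a, sigma_weak_seminorm h g a <= C * nrm a.
Proof.
move=> hs gs.
pose hn k := nrm (h k) ^+ 2 : R; pose gn k := nrm (g k) ^+ 2 : R.
have sum_le (u : R^nat) n : cvgn (series u) -> (forall k, 0 <= u k) ->
    series u n <= limn (series u).
  move=> us u0; apply: nondecreasing_cvgn_le => // k l kl.
  by rewrite -subr_ge0 sub_series_geq// sumr_ge0.
pose C := limn (series hn) + limn (series gn).
have C0 : 0 <= C.
  have := @sum_le hn 0 hs (fun k => sqr_ge0 _).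
  have := @sum_le gn 0 gs (fun k => sqr_ge0 _).
  by rewrite /series/= !big_geq// /C => ? ?; rewrite addr_ge0.
exists C => a; rewrite /sigma_weak_seminorm.
(* The limit of a divergent series is the default point 0. *)
have [cv|/dvgP ->] := pselect (cvgn (series (fun k => hdot (a (h k)) (g k) : R[i]^o))); last first.
  by rewrite [nrm _](@nrm0 R R[i]^o) mulr_ge0// nrm_ge0.
apply/ler_addgt0Pr => e e0; have [N NP] := (nrm_cvgP _ _).1 cv _ e0.
rewrite (le_trans (@nrm_le_dist _ R[i]^o _
  (series (fun k => hdot (a (h k)) (g k) : R[i]^o) N)))// lerD//; last first.
  by rewrite (@nrm_distC _ R[i]^o) ltW// NP.
rewrite (le_trans (@nrm_sum _ R[i]^o _ _ _ _))//.
apply: (@le_trans _ _ ((series hn N + series gn N) * nrm a)); last first.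
  rewrite ler_wpM2r ?nrm_ge0// lerD// sum_le// => k; exact: sqr_ge0.
rewrite /series/= -big_split/= mulr_suml; apply: ler_sum => k _.
rewrite (le_trans (hdot_cauchy_schwarz _ _))//.
rewrite (le_trans (ler_wpM2r (nrm_ge0 _) (nrm_bop_apply _ _)))//.
rewrite -mulrA mulrC ler_wpM2r ?nrm_ge0// /hn /gn.
have := sqr_ge0 (nrm (h k) - nrm (g k)).
have := sqr_ge0 (nrm (h k)); have := sqr_ge0 (nrm (g k)).
by nra.
Qed.

(** Finitely many of the defining semi-norms control phi, and each of them is bounded
    for the operator norm. *)
Lemma predual_bounded phi : in_predual phi ->
  exists K : R, forall a, nrm (phi a) <= K * nrm a.
Proof.
move=> /(_ 1 ltr01)[n [h [g [d [hs gs d0 small]]]]].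
have [C CP] : exists C : 'I_n -> R, forall i a,
    sigma_weak_seminorm (h i) (g i) a <= C i * nrm a.
  have /choice[C CP] : forall i : 'I_n, exists C : R, forall a,
      sigma_weak_seminorm (h i) (g i) a <= C * nrm a.
    by move=> i; exact: sigma_weak_seminorm_le.
  by exists C.
pose D := 1 + \sum_(i < n) `|C i|.
have D0 : 0 < D by rewrite ltr_pwDl// sumr_ge0.
have CD i : C i <= D.
  rewrite (le_trans (ler_norm _))// /D (bigD1 i)//= addrCA lerDl addr_ge0//.
  by rewrite sumr_ge0.
have t0 : 0 < d / (2 * D) by rewrite divr_gt0// mulr_gt0.
exists (d / (2 * D))^-1 => a; rewrite {1}(normalizeK a) linearZ.
rewrite [X in X <= _](@nrmZ R R[i]^o) nrmc_real ger0_norm ?nrm_ge0// mulrC.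
rewrite ler_wpM2r ?nrm_ge0//; have [->|a0] := eqVneq a 0.
  by rewrite scaler0 linear0 nrm0 invr_ge0 ltW.
set b := _ *: a; have b1 : nrm b = 1 by exact: nrm_normalize.
rewrite -[leRHS]mul1r ler_pdivlMr// mulrC -{1}(ger0_norm (ltW t0)).
rewrite -nrmc_real -(@nrmZ R R[i]^o) -linearZ ltW// small// => i.
rewrite (le_lt_trans (CP _ _))// nrmZ b1 mulr1 nrmc_real ger0_norm ?(ltW t0)//.
rewrite (le_lt_trans (ler_wpM2r (ltW t0) (CD i)))//.
have -> : D * (d / (2 * D)) = d / 2 by field; rewrite gt_eqF.
by lra.
Qed.

Lemma le_of_powers (s t K : R) : 0 <= s -> 0 <= t ->
  (forall k, s ^+ (2 ^ k) <= K * t ^+ (2 ^ k)) -> s <= t.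
Proof.
move=> s0 t0 stK; rewrite leNgt; apply/negP => ts.
have {}s0 : 0 < s := le_lt_trans t0 ts.
have q1 : t / s < 1 by rewrite ltr_pdivrMr ?mul1r.
have q0 : 0 <= t / s by rewrite divr_ge0// ltW.
have /cvgrPdist_lt/(_ _ ltr01)[N _ NP] : geometric K (t / s) @ \oo --> (0 : R).
  by apply: cvg_geometric; rewrite ger0_norm.
have := NP N (leqnn N); rewrite /= sub0r normrN; apply/negP; rewrite -leNgt.
rewrite (le_trans _ (ler_norm _))//.
have KN : 1 <= K * (t / s) ^+ (2 ^ N).
  by rewrite expr_div_n mulrA ler_pdivlMr ?exprn_gt0// mul1r.
have K0 : 0 <= K.
  rewrite leNgt; apply/negP => Kneg; have := stK 0%N; rewrite expn0 !expr1.
  by nra.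
rewrite (le_trans KN)// ler_wpM2l// ler_wiXn2l ?(ltW q1)//.
exact/ltnW/ltn_expl.
Qed.

(** Iterating |phi(a)|^2 <= phi(a* a) gives |phi(a)|^(2^k) <= K |a|^(2^k) for every k,
    where K is any bound for phi; as k grows the constant K disappears. *)
Lemma state_le_nrm phi a : normal_state phi -> nrm (phi a) <= nrm a.
Proof.
move=> [/predual_bounded[K phiK] phi0 phi1].
have sq b : nrm (phi b) ^+ 2 <= nrm (phi (adj b * b)).
  rewrite (le_trans _ (ler_Re_nrm _))//.
  have := @state_cauchy_schwarz phi b 1 phi0.
  by rewrite adj1 !mul1r phi1; exact.
have K0 : 0 <= K.
  rewrite leNgt; apply/negP => Kneg; have := phiK 1.
  rewrite phi1 nrmc_real normr1; have := nrm_ge0 (1 : bop H); nra.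
apply: (@le_of_powers _ _ K); rewrite ?nrm_ge0// => k.
elim: k a => [|k IH] a; first by rewrite expn0 !expr1.
rewrite expnS !exprM; apply: (@le_trans _ _ (nrm (phi (adj a * a)) ^+ (2 ^ k))).
  by rewrite lerXn2r ?nnegrE ?exprn_ge0 ?nrm_ge0.
rewrite (le_trans (IH _))// ler_wpM2l// lerXn2r ?nnegrE ?exprn_ge0 ?nrm_ge0//.
rewrite (le_trans (nrm_bopM _ _))// expr2 ler_wpM2r ?nrm_ge0//.
exact: nrm_adj_le.
Qed.

Definition unit_bounded phi y :=
  forall j, complex.Re (phi (adj (y j) * y j)) <= 1.

(** Term by term this is the Cauchy-Schwarz inequality for phi; the right-hand sides
    add up to phi of a partial Gram sum. *)
Lemma sum_coef_le phi y x n m : normal_state phi -> unit_bounded phi y ->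
  \sum_(n <= j < m) coef phi y x j ^+ 2 <= nrm (gram x n m).
Proof.
move=> phiS y1; rewrite (le_trans _ (state_le_nrm (gram x n m) phiS))//.
rewrite (le_trans _ (ler_Re_nrm _))// /gram linear_sum Re_sum.
by apply: ler_sum => j _; apply: state_cauchy_schwarz => //; case: phiS.
Qed.

Lemma seminorm_le_l2norm phi y x : normal_state phi -> unit_bounded phi y ->
  l2 x -> (seminorm phi y x <= (l2norm x)%:E)%E.
Proof.
move=> phiS y1 xl; apply/seminorm_leP => [|n]; first exact: l2norm_ge0.
rewrite (le_trans (sum_coef_le _ _ _ _ _))//.
by apply: nrm_gram_le => v v1; exact: sqsum_le_l2norm.
Qed.

Lemma seminormsP p : seminorms p ->
  exists phi y, [/\ normal_state phi, unit_bounded phi y & p = seminorm phi y].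
Proof.
move=> [phi [y [phiS y1 ->]]]; exists phi, y; split=> // j.
by rewrite -lee_fin -y1; apply: ereal_sup_ubound; exists j.
Qed.

End States.

(** * Finite nets for a semi-norm *)

Section FiniteNets.
Local Open Scope ring_scope.
Local Open Scope complex_scope.
Context {R : realType} {H : hilbertType R}.
Implicit Types (x y z : nat -> bop H) (K : set (nat -> bop H))
  (phi : {linear bop H -> R[i]^o}).

Lemma real_grid (B d : R) : 0 < d ->
  exists M (f : R -> 'I_M.+1), forall s t, `|s| <= B -> `|t| <= B ->
    f s = f t -> `|s - t| <= d.
Proof.
move=> d0; pose g s := Num.truncn ((s + B) / d).
exists (Num.truncn ((B + B) / d)), (fun s => inord (g s)) => s t.
rewrite !ler_norml => /andP[Bs sB] /andP[Bt tB].
have gB u : u <= B -> (g u < (Num.truncn ((B + B) / d)).+1)%N.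
  move=> uB; rewrite ltnS /g; apply: le_truncn.
  by rewrite ler_pM2r ?invr_gt0// lerD2r.
move/(congr1 val); rewrite /= !inordK ?gB// => gst.
have cell u : - B <= u -> (g u)%:R <= (u + B) / d < (g u).+1%:R.
  move=> Bu; rewrite truncnS_gt andbT; have uB : 0 <= u + B by lra.
  by rewrite truncn_le// divr_ge0// ltW.
have := cell _ Bs; have := cell _ Bt; rewrite gst.
rewrite !ler_pdivlMr// !ltr_pdivrMr// -natr1 mulrDl mul1r.
by move=> /andP[? ?] /andP[? ?]; apply/andP; split; lra.
Qed.

(** Away from finitely many coordinates the semi-norm is uniformly small on K, and the
    finitely many remaining coefficients range over a bounded subset of a
    finite-dimensional space, which a grid cuts into finitely many small cells. *)
Lemma finite_net phi y K (B : R) : K `<=` l2 ->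
  (forall x j, K x -> coef phi y x j <= B) ->
  (forall e : R, 0 < e -> exists N, forall x m, K x ->
    \sum_(N <= j < m) coef phi y x j ^+ 2 <= e) ->
  forall e : R, 0 < e -> exists n (c : 'I_n -> nat -> bop H),
    (forall i, l2 (c i)) /\
    forall x, K x -> exists i, (seminorm phi y (x - c i)%R < e%:E)%E.
Proof.
move=> Kl2 KB Ktail e e0.
(* For two points in the same cell the tails contribute at most 4 e^2 / 32 to the
   square of their distance, the N first coefficients at most 2 N d^2 <= e^2 / 8. *)
have [|N NP] := Ktail (e ^+ 2 / 32); first by rewrite divr_gt0// exprn_gt0.
pose d := e / (4 * (N%:R + 1)).
have N0 : 0 < N%:R + 1 :> R by rewrite natr1.
have d0 : 0 < d by rewrite divr_gt0// mulr_gt0.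
have [M [f fP]] := real_grid B d0.
pose F := {ffun 'I_N -> 'I_M.+1 * 'I_M.+1}.
pose val x j := phi (adj (y j) * x j) : R[i].
pose cell x : F :=
  [ffun j : 'I_N => (f (complex.Re (val x j)), f (complex.Im (val x j)))].
have cellP x z : K x -> K z -> cell x = cell z -> (seminorm phi y (x - z)%R < e%:E)%E.
  move=> Kx Kz xz; apply: (@le_lt_trans _ _ (e / 2)%:E); last first.
    by rewrite lte_fin; lra.
  have valB u j : K u -> `|complex.Re (val u j)| <= B /\ `|complex.Im (val u j)| <= B.
    move=> Ku; have := KB _ j Ku; rewrite /coef -/(val u j).
    have := nrmc_sqr (val u j); have := nrm_ge0 (val u j : R[i]^o).
    move: (nrm _) => t t0 tE tB.
    by split; rewrite (le_trans _ tB)// -(@ler_pXn2r _ 2)// ?nnegrE//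
      real_normK ?num_real// tE ?lerDl ?lerDr sqr_ge0.
  have head j : (j < N)%N -> coef phi y (x - z) j ^+ 2 <= 2 * d ^+ 2.
    move=> jN; move/ffunP : xz => /(_ (Ordinal jN)); rewrite !ffunE => -[] fRe fIm.
    have [xR xI] := valB _ j Kx; have [zR zI] := valB _ j Kz.
    have := fP _ _ xR zR fRe; have := fP _ _ xI zI fIm.
    rewrite /coef; have -> : phi (adj (y j) * (x - z) j) = val x j - val z j.
      by rewrite -linearB -mulrBr.
    rewrite nrmc_sqr; case: (val x j) (val z j) => [a a'] [b b'] /=.
    rewrite -[`|a' - b'| <= _](@ler_pXn2r _ 2)// ?nnegrE ?(ltW d0)//.
    rewrite -[`|a - b| <= _](@ler_pXn2r _ 2)// ?nnegrE ?(ltW d0)//.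
    by rewrite !real_normK ?num_real//; lra.
  have tail m : \sum_(N <= j < m) coef phi y (x - z) j ^+ 2 <= e ^+ 2 / 8.
    apply: (@le_trans _ _ (\sum_(N <= j < m)
        (2 * coef phi y x j ^+ 2 + 2 * coef phi y z j ^+ 2))).
      apply: ler_sum => j _.
      have : coef phi y (x - z) j ^+ 2 <= (coef phi y x j + coef phi y z j) ^+ 2.
        rewrite ler_pXn2r// ?nnegrE ?addr_ge0 ?nrm_ge0//.
        rewrite (le_trans (coefD _ _ _ _ _))// lerD2l /coef.
        by rewrite seqNE mulrN linearN nrmN.
      by have := sqr_ge0 (coef phi y x j - coef phi y z j); nra.
    rewrite big_split/= -!mulr_sumr.
    by have := NP _ m Kx; have := NP _ m Kz; lra.
  apply/seminorm_leP => [|m]; first by rewrite divr_ge0// ltW.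
  apply: (@le_trans _ _ (\sum_(0 <= j < maxn N m) coef phi y (x - z) j ^+ 2)).
    rewrite (big_cat_nat (leq0n m) (leq_maxr N m))/= lerDl sumr_ge0// => j _.
    exact: sqr_ge0.
  rewrite (big_cat_nat (leq0n N) (leq_maxl N m))/=.
  have : \sum_(0 <= j < N) coef phi y (x - z) j ^+ 2 <= e ^+ 2 / 8.
    apply: (@le_trans _ _ (\sum_(0 <= j < N) 2 * d ^+ 2)).
      by apply: ler_sum_nat => j /andP[_]; exact: head.
    rewrite sumr_const_nat subn0 -[_ *+ N]mulr_natr.
    have -> : 2 * d ^+ 2 * N%:R = e ^+ 2 / 8 * (N%:R / (N%:R + 1) ^+ 2).
      by rewrite /d; field; rewrite gt_eqF.
    rewrite ler_piMr ?divr_ge0 ?sqr_ge0// ler_pdivrMr ?exprn_gt0// mul1r.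
    by have := ler0n R N; nra.
  by have := tail (maxn N m); rewrite expr_div_n; lra.
have /choice[c cP] : forall k : F, exists c, l2 c /\ forall x, K x -> cell x = k ->
    (seminorm phi y (x - c)%R < e%:E)%E.
  move=> k; have [[c [Kc ck]]|nc] := pselect (exists c, K c /\ cell c = k).
    exists c; split=> [|x Kx xk]; first exact: Kl2.
    by apply: cellP => //; rewrite xk ck.
  by exists 0; split=> [|x Kx xk]; [exact: l2_0|exfalso; apply: nc; exists x].
exists #|{: F}|, (fun i => c (enum_val i)); split=> [i|x Kx].
  by have [] := cP (enum_val i).
by exists (enum_rank (cell x)); rewrite enum_rankK; apply: (cP _).2.
Qed.

End FiniteNets.

(** * Free finitely generated submodules *)

Section FreeSubmodules.
Local Open Scope ring_scope.
Local Open Scope complex_scope.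
Context {R : realType} {H : hilbertType R}.
Implicit Types (x y z : nat -> bop H) (E M : set (nat -> bop H))
  (phi : {linear bop H -> R[i]^o}).

Lemma additive_sum (U V : zmodType) (f : U -> V) : {morph f : a b / a + b} ->
  forall I (r : seq I) (F : I -> U), f (\sum_(i <- r) F i) = \sum_(i <- r) f (F i).
Proof.
move=> fD I r F; have f0 : f 0 = 0.
  by apply: (@addrI _ (f 0)); rewrite -fD !addr0.
exact: (big_morph _ fD f0).
Qed.

(** The tails of the generators control those of all bounded combinations. *)
Lemma uniform_tail_sum (I : eqType) (r : seq I) (g : I -> nat -> bop H) (D : R) :
  (forall i, l2 (g i)) -> 0 < D -> forall e : R, 0 < e ->
  exists N, forall (a : I -> bop H) n m v, (forall i, nrm (a i) <= D) ->
    (N <= n)%N -> nrm v <= 1 ->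
    sqsum (\sum_(i <- r) l2act (g i) (a i)) n m v <= e.
Proof.
move=> gl2 D0; elim: r => [|i r IH] e e0.
  exists 0%N => a n m v _ _ _; rewrite big_nil (@sqsum_supp _ _ 0)// ltW//.
have [N NP] := IH (e / 4) (divr_gt0 e0 (ltr0n _ 4)).
have /l2P/(_ (e / 4 / D ^+ 2))[|N' N'P] := gl2 i.
  by rewrite !divr_gt0// exprn_gt0.
exists (maxn N N') => a n m v aD; rewrite geq_max => /andP[Nn N'n] v1.
rewrite big_cons (le_trans (sqsumD_le _ _ _ _ _))//.
have h1 := NP a n m v aD Nn v1.
suff : sqsum (l2act (g i) (a i)) n m v <= e / 4 by lra.
rewrite sqsum_act (@le_trans _ _ (e / 4 / D ^+ 2 * nrm (a i v) ^+ 2))//.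
  apply: sqsum_scale => [|w w1]; first by rewrite !divr_ge0 ?sqr_ge0// ltW.
  by apply: N'P => //; rewrite w1.
rewrite -[_ / D ^+ 2 * _]mulrA ler_piMr ?divr_ge0 ?(ltW e0)// mulrC.
rewrite ler_pdivrMr ?exprn_gt0// mul1r ler_pXn2r ?nnegrE ?nrm_ge0 ?(ltW D0)//.
rewrite (le_trans (nrm_bop_apply _ _))// -[leRHS]mulr1.
by rewrite ler_pM ?nrm_ge0.
Qed.

(** An element of a free submodule is the combination of the images of the canonical
    basis, with coefficients no larger than its norm. *)
Lemma free_uniform_tail M (D : R) : free_fg M -> 0 < D -> forall e : R, 0 < e ->
  exists N, forall x n m v, M x -> l2norm x <= D -> (N <= n)%N -> nrm v <= 1 ->
    sqsum x n m v <= e.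
Proof.
move=> [[Ml2 _ _ _ _] [k [f [fD fact fdot finj fM]]]] D0 e e0.
pose b i : 'I_k -> bop H := fun l => (l == i)%:R.
have bl2 i : l2 (f (b i)) by apply: Ml2; rewrite -fM; exists (b i).
have [N NP] := uniform_tail_sum (index_enum 'I_k) bl2 D0 e0.
exists N => x n m v; rewrite -fM => -[a _ <-] aD Nn v1.
have -> : f a = \sum_i l2act (f (b i)) (a i).
  have {1}-> : a = \sum_i (fun l => b i l * a i).
    apply/funext => l; rewrite fct_sumE (bigD1 l)//= /b eqxx mul1r big1 ?addr0//.
    by move=> i il; rewrite eq_sym (negbTE il) mul0r.
  by rewrite (additive_sum fD); apply: eq_bigr => i _; rewrite fact.
apply: NP => // i; apply: nrm_bop_le => w w1.
rewrite (le_trans _ aD)// -(@ler_pXn2r _ 2)// ?nnegrE ?nrm_ge0 ?l2norm_ge0//.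
rewrite l2norm_sqr fdot.
have -> : nrm (a i w) ^+ 2 = complex.Re (hdot (a i w) (a i w)) by rewrite hdotxx.
apply: (@le_trans _ _ (complex.Re (hdot ((\sum_i adj (a i) * a i) w) w))).
  rewrite bop_sumE hdot_suml Re_sum (bigD1 i)// bopME hdot_adjl lerDl.
  by apply: sumr_ge0 => j _; rewrite bopME hdot_adjl hdotxx/= sqr_ge0.
rewrite (le_trans (ler_Re_nrm _))// (le_trans (hdot_cauchy_schwarz _ _))//.
rewrite (le_trans (ler_wpM2l (nrm_ge0 _) w1))// mulr1.
by rewrite (le_trans (nrm_bop_apply _ _))// ler_piMr// nrm_ge0.
Qed.

Lemma free_finite_net phi y M (D : R) : normal_state phi -> unit_bounded phi y ->
  free_fg M -> 0 < D -> forall e : R, 0 < e ->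
  exists n (c : 'I_n -> nat -> bop H), (forall i, l2 (c i)) /\
    forall x, M x -> l2norm x <= D -> exists i, (seminorm phi y (x - c i)%R < e%:E)%E.
Proof.
move=> phiS y1 Mfree D0 e e0; have [[Ml2 _ _ _ _] _] := Mfree.
have [||d d0|n [c [cl2 cP]]] :=
    @finite_net _ _ phi y (M `&` [set x | l2norm x <= D]) D _ _ _ e e0.
- by move=> x [/Ml2].
- move=> x j [Mx xD]; rewrite -(@ler_pXn2r _ 2)// ?nnegrE ?nrm_ge0 ?(ltW D0)//.
  have := sum_coef_le x j j.+1 phiS y1; rewrite big_nat1 => /le_trans; apply.
  apply: nrm_gram_le => v v1; rewrite (le_trans (sqsum_le_l2norm _ _ _ v1))//.
    exact: Ml2.
  by rewrite ler_pXn2r// ?nnegrE ?l2norm_ge0 ?(ltW D0).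
- have [N NP] := free_uniform_tail Mfree D0 d0.
  exists N => x m [Mx xD]; rewrite (le_trans (sum_coef_le _ _ _ phiS y1))//.
  by apply: nrm_gram_le => v v1; exact: NP.
by exists n, c; split=> // x Mx xD; exact: cP.
Qed.

(** A point of E lies at distance less than eta from some z in M of bounded norm, and
    the elements of M of bounded norm have a finite net for the semi-norm. *)
Lemma chi_le_lambda E p : E `<=` l2 -> l2bounded E -> seminorms p ->
  (chi E p <= lambda E)%E.
Proof.
move=> El2 [C EC] /seminormsP[phi [y [phiS y1 ->]]].
apply: le_ereal_inf_tmp => _ [eta [eta0 [M Mfree Meta]] <-].
have [[Ml2 _ _ _ _] _] := Mfree.
apply/lee_addgt0Pr => e e0; rewrite -EFinD.
apply: ereal_inf_lbound; exists (eta + e) => //; split; first by rewrite addr_gt0.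
(* D bounds the norm of any z at distance less than eta from a point of E. *)
pose D := 2 * (`|C| + eta).
have D0 : 0 < D by rewrite mulr_gt0// ltr_wpDl.
have [n [c [cl2 cP]]] := free_finite_net phiS y1 Mfree D0 e0.
exists n, c; split=> // x Ex.
have [_ [z Mz <-] xz] : exists2 d : \bar R,
    [set (l2norm (x - z)%R)%:E | z in M] d & (d < eta%:E)%E.
  apply: ereal_inf_lt; apply: (le_lt_trans _ Meta).
  by apply: ereal_sup_ubound; exists x.
have xl2 := El2 _ Ex; have zl2 := Ml2 _ Mz.
rewrite lte_fin in xz.
have [||i ci] := cP z; rewrite // /D.
  apply: l2norm_le => // [|m v v1]; first by rewrite ltW.
  rewrite -[z](subKr x) (le_trans (sqsumD_le _ _ _ _ _))// sqsumN.
  have := sqsum_le_l2norm 0 m xl2 v1.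
  have := sqsum_le_l2norm 0 m (l2_sub xl2 zl2) v1.
  have : l2norm x ^+ 2 <= `|C| ^+ 2.
    by rewrite ler_pXn2r ?nnegrE ?l2norm_ge0// (le_trans (EC _ Ex))// ler_norm.
  have : l2norm (x - z) ^+ 2 <= eta ^+ 2.
    by rewrite ler_pXn2r ?nnegrE ?l2norm_ge0 ?(ltW eta0)// ltW.
  have := normr_ge0 C; nra.
exists i => //; apply: seminorm_lt_dist ci.
by rewrite (le_lt_trans (seminorm_le_l2norm phiS y1 _))//; exact: l2_sub.
Qed.

End FreeSubmodules.

(** * Unitaries and vector states *)

Section Reflections.
Local Open Scope ring_scope.
Local Open Scope complex_scope.
Context {R : realType} {H : hilbertType R}.
Implicit Types (c : R[i]) (v w h : H).

Lemma reflection_bounded c w : (fun x => x - c *: (hdot x w *: w)) \in @bounded_linear _ H.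
Proof.
apply/bounded_linearP; split=> [a x y|].
  rewrite hdotDl hdotZl scalerDl !scalerDr -!scalerA scalerN opprD addrACA.
  by rewrite [c *: (a *: _)]scalerA mulrC -scalerA.
exists (1 + nrm (c : R[i]^o) * (nrm w * nrm w)) => x.
rewrite (le_trans (ler_nrmD _ _))// nrmN !nrmZ mulrDl mul1r lerD2l -mulrA.
rewrite ler_wpM2l ?nrm_ge0// mulrC -mulrA ler_wpM2l ?nrm_ge0// [leRHS]mulrC.
exact: hdot_cauchy_schwarz.
Qed.

Definition reflection c w : bop H := Bop (reflection_bounded c w).

Lemma reflectionE c w x : reflection c w x = x - c *: (hdot x w *: w).
Proof. by []. Qed.

Lemma adj_reflection c w : adj (reflection c w) = reflection c^*%C w.
Proof.
apply: adj_unique => x y; rewrite !reflectionE hdotBl hdotBr !hdotZl !hdotZr conjcK.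
by rewrite (hdotC y w) conjcK [hdot w y * _]mulrC.
Qed.

Lemma reflectionK c w : c + c^*%C = c * c^*%C * hdot w w ->
  reflection c^*%C w * reflection c w = 1.
Proof.
move=> cw; apply: bopext => x; rewrite bopME !reflectionE hdotBl !hdotZl.
rewrite !scalerA -addrA -opprD -scalerDl.
suff -> : c * hdot x w + c^*%C * (hdot x w - c * (hdot x w * hdot w w)) = 0.
  by rewrite scale0r subr0.
move: cw; move: (hdot x w) (hdot w w) => s t cw.
rewrite mulrBr addrA -mulrDl cw; ring.
Qed.

(** The complex reflection along h - v with coefficient 1 / (1 - <h, v>); its value at
    h is v, and it is unitary because |h - v|^2 is twice the real part of 1 - <h, v>. *)
Lemma unitary_transitive h v : nrm h = 1 -> nrm v = 1 ->
  exists2 u, unitary u & u h = v.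
Proof.
move=> h1 v1; pose z := 1 - hdot h v.
have hh : hdot h h = 1 by rewrite hdotxx h1 expr1n.
have vv : hdot v v = 1 by rewrite hdotxx v1 expr1n.
have ww : hdot (h - v) (h - v) = z + z^*%C.
  by rewrite hdotBl !hdotBr hh vv (hdotC v h) /z rmorphB rmorph1; ring.
have [z0|z0] := eqVneq z 0.
  exists 1; first by split; rewrite adj1 mul1r.
  apply/eqP; rewrite -subr_eq0; apply/eqP/nrm0_eq0/eqP.
  move: ww; rewrite z0 conjc0 addr0 hdotxx => /(congr1 (@complex.Re R))/eqP.
  by rewrite /= sqrf_eq0.
have cw : z^-1 + z^-1^*%C = z^-1 * z^-1^*%C * hdot (h - v) (h - v).
  by rewrite ww conjc_inv; field; rewrite conjc_eq0 z0.
exists (reflection z^-1 (h - v)).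
  rewrite /unitary adj_reflection; split; first exact: reflectionK.
  rewrite -{1}[z^-1]conjcK; apply: reflectionK; rewrite conjcK addrC cw.
  by rewrite [z^-1^*%C * _]mulrC.
rewrite reflectionE hdotBr hh -/z scalerA mulVf// scale1r.
by rewrite opprB addrCA subrr addr0.
Qed.

Definition vector_state h (a : bop H) : R[i]^o := hdot (a h) h.

Lemma vector_state_linear h : linear (vector_state h).
Proof. by move=> z a b; rewrite /vector_state bopDE bopZE hdotDl hdotZl. Qed.

HB.instance Definition _ h :=
  GRing.isLinear.Build R[i] (bop H) R[i]^o *:%R (vector_state h)
    (vector_state_linear h).

Lemma vector_state_adj h (a b : bop H) :
  vector_state h (adj b * a) = hdot (a h) (b h).
Proof. by rewrite /vector_state bopME hdot_adjl. Qed.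

Lemma series_single (V : normedModType R[i]) (u : nat -> V) :
  (forall k, (0 < k)%N -> u k = 0) -> series u n @[n --> \oo] --> u 0%N.
Proof.
move=> u0; apply/nrm_cvgP => e e0; exists 1%N => -[//|n] _.
rewrite /series/= big_nat_recl// big1 ?addr0 ?subrr ?nrm0// => k _.
exact: u0.
Qed.

(** The modulus of a vector state is one of the semi-norms that define the topology, for
    square summable sequences with a single nonzero entry. *)
Lemma vector_state_normal h : nrm h = 1 -> normal_state (vector_state h).
Proof.
move=> h1; split=> [e e0|a|].
- pose hs k := if k is 0%N then h else 0 : H.
  have hsq : sqsummable hs.
    apply/cvg_ex; exists 1; apply/cvgrPdist_lt => e' e'0; exists 1%N => // -[//|n] _.
    rewrite /series/= big_nat_recl// big1 => [|k _]; last by rewrite nrm0 expr0n.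
    by rewrite /hs h1 expr1n addr0 subrr normr0.
  exists 1%N, (fun=> hs), (fun=> hs), e; split => // a /(_ ord0).
  rewrite /sigma_weak_seminorm.
  rewrite (nrm_cvg_unique (@series_single R[i]^o _ _))// => -[//|k] _ /=.
  by rewrite hdot0r.
- by rewrite [X in _ <= X]vector_state_adj hdotxx lecR sqr_ge0.
- by rewrite [LHS](_ : _ = hdot h h)// hdotxx h1 expr1n.
Qed.

Lemma vector_state_exists h : nrm h = 1 ->
  exists2 phi : {linear bop H -> R[i]^o}, normal_state phi &
    forall a b, phi (adj b * a) = hdot (a h) (b h).
Proof.
move=> h1; exists (vector_state h); first exact: vector_state_normal.
exact: vector_state_adj.
Qed.

End Reflections.

(** * Coordinate submodules *)

Section CoordinateModules.
Local Open Scope ring_scope.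
Local Open Scope complex_scope.
Context {R : realType} {H : hilbertType R}.
Implicit Types (x y z : nat -> bop H) (E : set (nat -> bop H)).

Definition ext0 n (a : 'I_n -> bop H) : nat -> bop H :=
  fun j => oapp a 0 (insub j).

Lemma ext0_ord n (a : 'I_n -> bop H) (i : 'I_n) : ext0 a i = a i.
Proof. by rewrite /ext0 valK. Qed.

Lemma ext0_supp n (a : 'I_n -> bop H) : finitely_supported n (ext0 a).
Proof. by move=> j nj; rewrite /ext0 insubF// ltnNge nj. Qed.

Lemma ext0K n x : finitely_supported n x -> ext0 (fun i : 'I_n => x i) = x.
Proof.
move=> xn; apply/funext => j; have [jn|nj] := ltnP j n.
  exact: (ext0_ord (fun i : 'I_n => x i) (Ordinal jn)).
by rewrite ext0_supp// xn.
Qed.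

Lemma ext0_ext n x (a : 'I_n -> bop H) : finitely_supported n x ->
  (forall i : 'I_n, x i = a i) -> ext0 a = x.
Proof.
by move=> /ext0K xn xa; rewrite -[RHS]xn; congr ext0; apply/funext => i; rewrite xa.
Qed.

Lemma l2dot_supp n x y : finitely_supported n x ->
  l2dot x y = \sum_(i < n) adj (x i) * y i.
Proof.
move=> xn; apply: nrm_cvg_unique; apply/nrm_cvgP => e e0; exists n => m nm.
rewrite /series/= (big_cat_nat (leq0n n) nm)/= big_mkord [X in _ + X - _]big_nat_cond.
rewrite [X in _ + X - _]big1 ?addr0 ?subrr ?nrm0// => j /andP[/andP[nj _] _].
by rewrite xn// adj0 mul0r.
Qed.

Lemma free_coordinates n : free_fg (finitely_supported n : set (nat -> bop H)).
Proof.
split; last first.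
  exists n, (@ext0 n); split.
  - move=> a b; apply: ext0_ext => [j nj|i]; last by rewrite seqDE !ext0_ord.
    by rewrite seqDE !ext0_supp// addr0.
  - move=> a c; apply: ext0_ext => [j nj|i]; last by rewrite /l2act ext0_ord.
    by rewrite /l2act ext0_supp// mul0r.
  - move=> a b; rewrite (l2dot_supp _ (ext0_supp a)).
    by apply: eq_bigr => i _; rewrite !ext0_ord.
  - by move=> a b ab; apply/funext => i; rewrite -!ext0_ord ab.
  - apply/seteqP; split=> [_ [a _ <-]|x xn]; first exact: ext0_supp.
    by exists (fun i : 'I_n => x i) => //; exact: ext0K.
split=> [x|//|x y xn yn j nj|x a xn j nj|z x zn xl2 zx j nj].
- exact: l2_supp.
- by rewrite seqDE xn// yn// addr0.
- by rewrite /l2act xn// mul0r.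
- apply: nrm0_eq0; apply/eqP; rewrite eq_le nrm_ge0 andbT.
  apply/ler_addgt0Pr => e e0; rewrite add0r.
  move/cvgrPdist_lt : zx => /(_ _ e0)[N _ /(_ N (leqnn N))].
  rewrite /= sub0r normrN ger0_norm ?l2norm_ge0// => zxe.
  apply: nrm_bop_le => v v1; apply: le_trans (ltW zxe).
  rewrite -(@ler_pXn2r _ 2)// ?nnegrE ?nrm_ge0 ?l2norm_ge0//.
  have := sqsum_le_l2norm j j.+1 (l2_sub (l2_supp (zn N)) xl2) v1.
  by rewrite /sqsum big_nat1 seqBE zn// sub0r bopNE nrmN.
Qed.

Lemma lambda_ge0 E : (0 <= lambda E)%E.
Proof. by apply: le_ereal_inf_tmp => _ [e [e0 _] <-]; rewrite lee_fin ltW. Qed.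

(** The distance to the zero submodule is the norm. *)
Lemma lambda_le_l2sup E : l2bounded E -> (lambda E <= l2sup E)%E.
Proof.
move=> [C EC]; apply/lee_addgt0Pr => e e0.
have sC : (l2sup E <= `|C|%:E)%E.
  apply: esup0_le => [|_ [x Ex <-]]; first by rewrite lee_fin.
  by rewrite lee_fin (le_trans (EC _ Ex))// ler_norm.
have s0 : (0 <= l2sup E)%E by exact: esup0_ge0.
have sup_ub x : E x -> ((l2norm x)%:E <= l2sup E)%E.
  by move=> Ex; apply: esup0_ub; exists x.
case: (l2sup E) s0 sC sup_ub => [r| |]// r0 _ rub.
rewrite lee_fin in r0; rewrite -EFinD; apply: ereal_inf_lbound.
exists (r + e) => //; split; first by rewrite ltr_wpDl.
exists (finitely_supported 0); first exact: free_coordinates.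
apply: (@le_lt_trans _ _ r%:E); last by rewrite lte_fin ltrDl.
apply: ge_ereal_sup => _ [x Ex <-]; apply: le_trans (rub _ Ex).
by apply: ereal_inf_lbound; exists 0 => //; rewrite subr0.
Qed.

(** An element far from the module of the first n coordinates has a large tail, hence a
    tail that is large at some vector. *)
Lemma far_tail E (d : R) n : E `<=` l2 -> 0 <= d -> (d%:E < lambda E)%E ->
  exists x v m, [/\ E x, nrm v = 1 & d ^+ 2 < sqsum x n m v].
Proof.
move=> El2 d0 dE; apply: contrapT => small.
have {}small x m v : E x -> nrm v = 1 -> sqsum x n m v <= d ^+ 2.
  by move=> Ex v1; rewrite leNgt; apply/negP => ?; apply: small; exists x, v, m.
have : (lambda E <= d%:E)%E.
  apply/lee_addgt0Pr => e e0; rewrite -EFinD; apply: ereal_inf_lbound.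
  exists (d + e) => //; split; first by rewrite ltr_wpDl.
  exists (finitely_supported n); first exact: free_coordinates.
  apply: (@le_lt_trans _ _ d%:E); last by rewrite lte_fin ltrDl.
  apply: ge_ereal_sup => _ [x Ex <-].
  pose y := ext0 (fun i : 'I_n => x i).
  have yn : finitely_supported n y := ext0_supp _.
  apply: (@le_trans _ _ (l2norm (x - y))%:E).
    by apply: ereal_inf_lbound; exists y.
  rewrite lee_fin; apply: l2norm_le => // [|m v v1].
    by apply: l2_sub; [exact: El2|exact: l2_supp yn].
  apply: (@le_trans _ _ (sqsum x n m v)); last first.
    rewrite (le_trans (sqsum_scale _ (sqr_ge0 d) (fun w => small x m w Ex)))//.
    by rewrite ler_piMr ?sqr_ge0// expr_le1// nrm_ge0.
  have head k : (k <= n)%N -> sqsum (x - y) 0 k v = 0.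
    move=> kn; rewrite /sqsum big_nat_cond big1// => j /andP[/andP[_ jk] _].
    have jn := leq_trans jk kn.
    rewrite seqBE /y (ext0_ord (fun i : 'I_n => x i) (Ordinal jn)).
    by rewrite subrr nrm0 expr0n.
  have [nm|mn] := leqP n m; last by rewrite head ?sqsum_ge0// ltnW.
  rewrite (@sqsum_cat _ _ _ n 0)// head// add0r /sqsum big_nat [leRHS]big_nat.
  apply: ler_sum => j /andP[nj _].
  by rewrite seqBE yn// subr0.
by rewrite leNgt dE.
Qed.

End CoordinateModules.

(** * The gliding hump *)

Section GlidingHump.
Local Open Scope ring_scope.
Local Open Scope complex_scope.
Context {R : realType} {H : hilbertType R}.
Implicit Types (x y z : nat -> bop H) (E : set (nat -> bop H)).

(** Unitaries move all the vectors at which the tails are large to a single one. *)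
Lemma hump E (d e : R) : E `<=` l2 -> balanced E -> 0 <= d -> (d%:E < lambda E)%E ->
  0 < e -> exists2 h : H, nrm h = 1 &
    forall n, exists xm : (nat -> bop H) * nat,
      [/\ E xm.1, (n < xm.2)%N, d ^+ 2 < sqsum xm.1 n xm.2 h &
        forall k, sqsum xm.1 xm.2 k h <= e].
Proof.
move=> El2 Ebal d0 dE e0.
have [_ [h [_ [_ h1 _]]]] := far_tail 0 El2 d0 dE.
exists h => // n; have [x [v [m [Ex v1 xm]]]] := far_tail n El2 d0 dE.
have [u uu uh] := unitary_transitive h1 v1.
have [N NP] := (l2P _).1 (El2 _ Ex) _ e0.
have nm : (n < m)%N.
  rewrite ltnNge; apply/negP => mn; move: xm; rewrite /sqsum big_geq//.
  by rewrite ltNge sqr_ge0.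
exists (l2act x u, maxn m N) => /=; split.
- exact: Ebal.
- by rewrite (leq_trans nm)// leq_maxl.
- by rewrite sqsum_act uh (lt_le_trans xm)// sqsum_leqr// leq_maxl.
- by move=> k; rewrite sqsum_act uh NP ?leq_maxr ?v1.
Qed.

(** On the block [n, m) the sequence y picks out the full norm of x j h, while z is small
    there; the triangle inequality on the block separates x from z. *)
Lemma block_separation (phi : {linear bop H -> R[i]^o}) h y x z n m (d e : R) :
  (forall a b, phi (adj b * a) = hdot (a h) (b h)) ->
  (forall j, nrm (y j h) = 1) ->
  (forall j, (n <= j < m)%N -> nrm (hdot (x j h) (y j h) : R[i]^o) = nrm (x j h)) ->
  0 < e -> (d + e) ^+ 2 < sqsum x n m h -> sqsum z n m h <= e ^+ 2 ->
  (d%:E <= seminorm phi y (x - z)%R)%E.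
Proof.
move=> phiE y1 xy e0 big small; rewrite leNgt; apply/negP.
move=> /seminorm_ltP[r /andP[r0 rd]] /(seminorm_leP _ _ _ (ltW r0)) pr.
have : sqsum x n m h <= (r + e) ^+ 2.
  apply: (@minkowski_sum _ _ _ (coef phi y (x - z)) (fun j => nrm (z j h))) => //.
    move=> j jnm; rewrite nrm_ge0/= -(xy _ jnm) /coef phiE.
    apply: (@le_trans _ _ (nrm (hdot ((x - z) j h) (y j h) : R[i]^o) +
      nrm (hdot (z j h) (y j h) : R[i]^o))).
      by rewrite seqBE bopBE hdotBl addrC (@nrm_le_dist _ R[i]^o).
    rewrite lerD2l (le_trans (hdot_cauchy_schwarz _ _))//.
    by rewrite y1 mulr1.
  have [nm|mn] := leqP n m; last by rewrite big_geq ?sqr_ge0// ltnW.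
  apply: le_trans (pr m); rewrite [leRHS](big_cat_nat (leq0n n) nm)/= lerDr.
  by apply: sumr_ge0 => j _; exact: sqr_ge0.
rewrite leNgt => /negP; apply; apply: lt_trans big.
by rewrite ltrXn2r// ?nnegrE ?addr_ge0// ?ltrD2r// ?ltW// (lt_trans r0).
Qed.

(** Starting each hump where the previous element has become small gives disjoint blocks
    [N k, N k.+1); y normalizes x_k on the k-th of them. *)
Lemma separated_sequence E (d e : R) : E `<=` l2 -> balanced E -> 0 < e -> 0 < d ->
  ((d + e)%:E < lambda E)%E ->
  exists p (x : nat -> nat -> bop H), [/\ seminorms p, (forall k, E (x k)) &
    forall l k, l != k -> (d%:E <= p (x l - x k)%R)%E].
Proof.
move=> El2 Ebal e0 d0 dE.
have [h h1 /choice[g gP]] := hump El2 Ebal (ltW (addr_gt0 d0 e0)) dE (exprn_gt0 2 e0).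
have [phi phiS phiE] := vector_state_exists h1.
pose N k := iter k (fun n => (g n).2) 0%N; pose x k := (g (N k)).1.
have NS k : (N k < N k.+1)%N by have [] := gP (N k).
have Nle k l : (k <= l)%N -> (N k <= N l)%N.
  elim: l => [|l IH]; first by rewrite leqn0 => /eqP ->.
  by rewrite leq_eqVlt => /predU1P[->//|/IH/leq_trans]; apply; exact: ltnW.
have block_uniq k l j : (N k <= j < N k.+1)%N -> (N l <= j < N l.+1)%N -> k = l.
  move=> /andP[kj jk] /andP[lj jl]; apply/eqP; rewrite eqn_leq.
  apply/andP; split; rewrite leqNgt; apply/negP => /Nle.
    by rewrite leqNgt (leq_ltn_trans kj jl).
  by rewrite leqNgt (leq_ltn_trans lj jk).
have /choice[y yP] : forall j, exists b : bop H, nrm (b h) = 1 /\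
    forall k, (N k <= j < N k.+1)%N -> nrm (hdot (x k j h) (b h) : R[i]^o) = nrm (x k j h).
  move=> j; have [[k kj]|nk] := pselect (exists k, (N k <= j < N k.+1)%N); last first.
    by exists 1; split=> // k kj; exfalso; apply: nk; exists k.
  have [xk0|xk0] := eqVneq (x k j h) 0.
    exists 1; split=> // l lj; rewrite -(block_uniq _ _ _ kj lj) xk0.
    by rewrite hdot0l !nrm0.
  exists ((nrm (x k j h))^-1%:C *: x k j); rewrite bopZE nrm_normalize//; split=> // l lj.
  rewrite -(block_uniq _ _ _ kj lj) hdotZr hdotxx conjc_real -rmorphM nrmc_real.
  by rewrite expr2 mulKf ?gt_eqF ?nrm_gt0// ger0_norm// nrm_ge0.
exists (seminorm phi y), x; split.
- exists phi, y; split=> //; rewrite -[RHS]ereal_sup1; congr ereal_sup.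
  have one j : complex.Re (phi (adj (y j) * y j)) = 1.
    by rewrite phiE hdotxx (yP j).1 expr1n.
  apply/seteqP; split=> [_ [j _ <-]|_ ->]; first by rewrite /= one.
  by exists 0%N => //; rewrite one.
- by move=> k; have [] := gP (N k).
suff sep l k : (l < k)%N -> (d%:E <= seminorm phi y (x k - x l)%R)%E.
  move=> l k; rewrite neq_ltn => /orP[lk|/sep//].
  by rewrite seminorm_subC sep.
move=> lk; have [_ _ big _] := gP (N k); have [_ _ _ small] := gP (N l).
apply: (block_separation phiE (fun j => (yP j).1) (fun j => (yP j).2 k) e0 big).
apply: le_trans (small (N k.+1)).
by rewrite [leRHS](@sqsum_cat _ _ _ (N k) (N l.+1)) ?lerDr ?sqsum_ge0 ?Nle// ltnW.
Qed.

Lemma lambda_le_istratescu E : E `<=` l2 -> balanced E ->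
  (lambda E <= star (@istratescu R H) E)%E.
Proof.
move=> El2 Ebal; rewrite leNgt; apply/negP => IE.
have I0 : (0 <= star (@istratescu R H) E)%E by exact: esup0_ge0.
have [d [e [e0 d0 Id dE]]] : exists d e : R, [/\ 0 < e, 0 < d,
    (star (@istratescu R H) E < d%:E)%E & ((d + e)%:E < lambda E)%E].
  case: (star _ _) (lambda E) I0 IE => [r| |] [s| |]//.
    rewrite lee_fin lte_fin => r0 rs; exists (r + (s - r) / 3), ((s - r) / 3).
    by split; rewrite ?lte_fin; lra.
  rewrite lee_fin => r0 _; exists (r + 1), 1.
  by split; rewrite ?lte_fin ?ltry//; lra.
have [p [x [pP xE xsep]]] := separated_sequence El2 Ebal e0 d0 dE.
have : (d%:E <= star (@istratescu R H) E)%E.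
  apply: (@le_trans _ _ (istratescu E p)); last by apply: esup0_ub; exists p.
  apply: esup0_ub; exists d => //; split=> //; exists (range x); split.
  - by move=> _ [k _ <-].
  - have xinj : injective x.
      move=> l k xlk; apply/eqP; apply: contraT => /xsep.
      rewrite xlk subrr; have [phi [y [_ _ ->]]] := pP.
      have : (seminorm phi y 0%R <= 0%:E)%E.
        apply/seminorm_leP => // n; rewrite big1 ?expr0n// => j _.
        by rewrite /coef mulr0 linear0 (@nrm0 R R[i]^o) expr0n.
      by move=> p0 /le_trans/(_ p0); rewrite lee_fin leNgt d0.
    move=> /(@finite_preimage _ _ _ x); rewrite preimage_range.
    by move=> /(_ (in2W xinj)); exact: infinite_nat.
  - move=> _ _ [l _ <-] [k _ <-] xlk; apply: xsep.
    by apply/eqP => lk; apply: xlk; rewrite lk.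
by rewrite leNgt Id.
Qed.

End GlidingHump.

Local Open Scope ereal_scope.

Theorem corollary4p5 (R : realType) (H : hilbertType R) (E : set (nat -> bop H))
    (El2 : E `<=` l2) (Ebounded : l2bounded E) (Ebalanced : balanced E) :
  [/\ star chi E <= lambda E,
      lambda E <= sqrte (l2sup E * star istratescu E),
      sqrte (l2sup E * star istratescu E) <= sqrte (l2sup E * star alpha E) &
      sqrte (l2sup E * star alpha E) <= sqrte (2%:E * l2sup E * star chi E)].
Proof.
have s0 : 0 <= l2sup E by exact: esup0_ge0.
have star0 mu : 0 <= star mu E by exact: esup0_ge0.
split.
- apply: esup0_le => [|_ [p pP <-]]; first exact: lambda_ge0.
  exact: chi_le_lambda.
- rewrite -[leLHS](gee0_abs (lambda_ge0 E)) -sqrte_sqr lee_sqrt ?mule_ge0//.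
  rewrite expe2 lee_pmul ?lambda_ge0//; first exact: lambda_le_l2sup.
  exact: lambda_le_istratescu.
- by rewrite lee_sqrt ?mule_ge0// lee_wpmul2l// star_istratescu_le_alpha.
- rewrite lee_sqrt ?mule_ge0 ?lee_fin// [2%:E * _]muleC -muleA lee_wpmul2l//.
  exact: star_alpha_le_chi.
Qed.
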